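(* Consider a $\pi$-regular saddle-point problem $\min_{x\in\mathcal X}\max_{y\in\mathcal Y}f(x)+\langle y,\mathbf Bx\rangle-g(y)$ with an admissible parameter vector $\pi=(L_x,L_y,L_{xy},\mu_x,\mu_y,\mu_{xy},\mu_{yx})$ satisfying $L_x>4\mu_x$, $L_y>4\mu_y$, $L_{xy}>18\max\{\mu_{xy},\mu_{yx},\sqrt{\mu_x\mu_y}\}$, $\sqrt{L_xL_y}>4\max\{\mu_{xy},\mu_{yx}\}$, and $\min\{\delta_x,\delta_y\}>0$, where $\delta_x=\mu_x+\mu_{xy}^2/L_y$, $\delta_y=\mu_y+\mu_{yx}^2/L_x$. Let $\kappa_x=L_x/\delta_x$, $\kappa_y=L_y/\delta_y$, $\kappa_{xy}=L_{xy}^2/(\delta_x\delta_y)$. Let $n=3$, $\mathcal Z=\mathcal C=\mathcal X\times\mathcal Y$, let $z_{\rm in}=(x_{\rm in},y_{\rm in})\in\mathcal Z$, and define for $z=(x,y)$ $$Q_1(z)=Q_2(z)=0,\quad Q_3(z)=(\mathbf B^\top y,-\mathbf Bx),\quad p_1(z)=f(x),\quad p_2(z)=g(y),$$ $$p_3(z)=\frac{\beta_x}{2}\|\mathbf Bx-\nabla g(y_{\rm in})\|^2+\frac{\beta_y}{2}\|\mathbf B^\top y+\nabla f(x_{\rm in})\|^2,\quad\beta_x=\frac1{4L_y},\ \beta_y=\frac1{4L_x},\quad \mathbf P=\mathrm{diag}(\delta_x\mathbf I_{d_x},\delta_y\mathbf I_{d_y}).$$ Then: (1) For $i=1,2,3$,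 the gradient $\nabla p_i$ is monotone and $L_i$-Lipschitz with respect to $\|\cdot\|_{\mathbf P}$, and $Q_i$ is monotone and $M_i$-Lipschitz with respect to $\|\cdot\|_{\mathbf P}$, with $$L_1=\kappa_x,\quad L_2=\kappa_y,\quad L_3=\kappa_{xy},\quad M_1=M_2=0,\quad M_3=\sqrt{\kappa_{xy}},$$ where $L_i,M_i\ge0$ and $L_i+M_i>0$. (2) Moreover, the input $z_{\rm in}=(x_{\rm in},y_{\rm in})$ and the output $z_{\rm out}=(x_{\rm out},y_{\rm out})$ of Algorithm 1 (described in the context), applied to these functions, operators, constants and $\mathbf P$, satisfy $$\Psi(z_{\rm out})\le\tfrac23\Psi(z_{\rm in}),$$ as long as the numbers of inner iterations $T_1,T_2,T_3$ are chosen according to the iteration rule given in the context, for a suitable value of its accuracy parameter $\epsilon>0$. Here $$\Psi(z)=\Psi(x,y)=\mathcal R^2_{\delta_x\delta_y}(x,y)+12\,\mathrm D_f(x,x^* )+12\,\mathrm D_g(y,y^* ),$$ where $z^*=(x^*,y^* )=\mathrm{proj}_{\mathcal S}(z_{\rm in})=\mathrm{proj}_{\mathcal S}(z_{\rm out})$.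
   Context: **Problem.** $\mathcal X=\mathbb R^{d_x}$, $\mathcal Y=\mathbb R^{d_y}$, $\mathbf B\in\mathbb R^{d_y\times d_x}$, $f:\mathcal X\to\mathbb R$ and $g:\mathcal Y\to\mathbb R$ differentiable convex. $\mathrm D_h(x,x')=h(x)-h(x')-\langle\nabla h(x'),x-x'\rangle$. A differentiable $h$ is $\mu$-strongly convex ($\mu\ge0$) if $\mathrm D_h(x,x')\ge\frac\mu2\|x-x'\|^2$ for all $x,x'$ (convex if $\mu=0$); a differentiable convex $h$ is $L$-smooth if $|\mathrm D_h(x,x')|\le\frac L2\|x-x'\|^2$ for all $x,x'$. **Parameters.** $\pi=(L_x,L_y,L_{xy},\mu_x,\mu_y,\mu_{xy},\mu_{yx})\in\mathbb R_+^7$ is admissible if $L_x>\mu_x\ge0$, $L_y>\mu_y\ge0$, $L_{xy}>\mu_{xy}\ge0$, $L_{xy}>\mu_{yx}\ge0$, and $\mu_{xy}=\mu_{yx}$ whenever both are positive. The problem is $\pi$-regular if: $f$ is $\mu_x$-strongly convex and $L_x$-smooth; $g$ is $\mu_y$-strongly convex and $L_y$-smooth; $\mu_{xy}^2\le\lambda_{\min}^+(\mathbf B^\top\mathbf B)$ if $\nabla f(x)\in\mathrm{range}\,\mathbf B^\top$ for all $x$, and $\mu_{xy}^2\le\lambda_{\min}(\mathbf B^\top\mathbf B)$ otherwise; $\mu_{yx}^2\le\lambda_{\min}^+(\mathbf B\mathbf B^\top)$ if $\nabla g(y)\in\mathrm{range}\,\mathbf B$ for all $y$, and $\mu_{yx}^2\le\lambda_{\min}(\mathbf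 B\mathbf B^\top)$ otherwise; $L_{xy}^2\ge\lambda_{\max}(\mathbf B^\top\mathbf B)$. ($\lambda_{\min},\lambda_{\min}^+,\lambda_{\max}$: smallest, smallest positive, largest eigenvalue.) **Solutions.** $\mathcal S\subset\mathcal X\times\mathcal Y$ is the solution set of the saddle-point problem, i.e. the set of $(x^*,y^* )$ with $\nabla f(x^* )+\mathbf B^\top y^*=0$ and $\nabla g(y^* )-\mathbf Bx^*=0$. With $P(x)=f(x)+g^*(\mathbf Bx)$, $D(y)=-g(y)-f^*(-\mathbf B^\top y)$ ($h^*$ the Fenchel conjugate), $\mathcal S_x=\mathrm{Argmin}\,P$, $\mathcal S_y=\mathrm{Argmax}\,D$; under the hypotheses $\mathcal S=\mathcal S_x\times\mathcal S_y$ is a nonempty affine subspace. $\mathrm{dist}(x;\mathcal A)=\min_{x'\in\mathcal A}\|x-x'\|$ and $\mathcal R^2_{\delta_x\delta_y}(x,y)=\delta_x\mathrm{dist}^2(x;\mathcal S_x)+\delta_y\mathrm{dist}^2(y;\mathcal S_y)$. $\mathrm{proj}_{\mathcal S}$ is the orthogonal projection onto $\mathcal S$. **Operators.** $\|z\|_{\mathbf P}=\sqrt{\langle\mathbf Pz,z\rangle}$, $\|z\|_{\mathbf P^{-1}}=\sqrt{\langle\mathbf P^{-1}z,z\rangle}$. $G$ is monotone if $\langle G(z)-G(z'),z-z'\rangle\ge0$ for all $z,z'$; $M$-Lipschitz w.r.t. $\|\cdot\|_{\mathbf P}$ if $\|G(z)-G(z')\|_{\mathbf P^{-1}}\le M\|z-z'\|_{\mathbf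 P}$ for all $z,z'$. **Algorithm 1** (for pairs $(p_i,Q_i)$, $i=1,\dots,n$, a closed convex set $\mathcal C\subset\mathcal Z$, input $z_{\rm in}\in\mathcal C$, constants $L_i,M_i$, positive integers $T_1,\dots,T_n$, positive definite matrix $\mathbf P$). Let $\alpha_0=1$, $\alpha_{t+1}=2\big(1+\sqrt{1+4/\alpha_t^2}\big)^{-1}$ for $t\ge0$. Write $t_{1:k}$ for $t_1,\dots,t_k$ (empty if $k=0$). Initialization: $z^i_{0,\dots,0}=z_{\rm in}$ ($i$ zero indices) and $p_i^{0}\equiv p_i$ for $i=1,\dots,n$. Output: $z_{\rm out}=\mathrm{Rec}(1)$. The recursive procedure $\mathrm{Rec}(k;t_{1:k-1})$ is: - If $k=n+1$: return $\arg\min_{z\in\mathcal C}\sum_{i=1}^np_i^{n;t_{1:n}}(z)$. - Otherwise set $\bar z^k_0=z^k_{t_{1:k-1},0}$ and, for $t_k=0,1,\dots,T_k-1$, do the following: 1. For $i=1,\dots,n$ set $\hat p_i^{k;t_{1:k}}(z)=\alpha_{t_k}^{-1}\,p_i^{k-1;t_{1:k-1}}\big(\alpha_{t_k}z+(1-\alpha_{t_k})\bar z^k_{t_k}\big)$ if $i\ge k$, and $\hat p_i^{k;t_{1:k}}(z)=p_i^{k-1;t_{1:k-1}}(z)$ if $i<k$; $L_i^{k;t_{1:k}}=L_i\prod_{l=1}^k\alpha_{t_l}$, $M_i^{k;t_{1:k}}=M_i\prod_{l=1}^k(\alpha_{t_l}/\alpha_{T_l-1})$, $H_i^{k;t_{1:k}}=L_i^{k;t_{1:k}}+M_i^{k;t_{1:k}}$;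 $\Delta_i^{k;t_{1:k}}=\nabla\hat p_i^{k;t_{1:k}}(z^k_{t_{1:k}})+Q_i(z^k_{t_{1:k}})$; $p_i^{k;t_{1:k}}(z)=\tfrac12H_k^{k;t_{1:k}}\|z-z^k_{t_{1:k}}\|_{\mathbf P}^2+\langle z,\Delta_k^{k;t_{1:k}}\rangle$ if $i=k$, and $p_i^{k;t_{1:k}}\equiv\hat p_i^{k;t_{1:k}}$ if $i\ne k$. 2. $z^k_{t_{1:k-1},t_k+1/2}=\mathrm{Rec}(k+1;t_{1:k})$. 3. $\bar z^k_{t_k+1}=\alpha_{t_k}z^k_{t_{1:k-1},t_k+1/2}+(1-\alpha_{t_k})\bar z^k_{t_k}$. 4. $\Delta_{Q_k}^{k;t_{1:k}}=Q_k(z^k_{t_{1:k}})-Q_k(z^k_{t_{1:k-1},t_k+1/2})$. 5. $z^k_{t_{1:k-1},t_k+1}=z^k_{t_{1:k-1},t_k+1/2}+(H_k^{k;t_{1:k}}\mathbf P)^{-1}\Delta_{Q_k}^{k;t_{1:k}}$. 6. For $l=k+1,\dots,n$: $z^l_{t_{1:k-1},t_k+1,0,\dots,0}=z^l_{t_{1:k-1},t_k,T_{k+1},0,\dots,0}$. After the loop return $\bar z^k_{T_k}$. **Iteration rule** (accuracy parameter $\epsilon>0$). The rule comes from the following complexity result for Algorithm 1: with $p=\sum_ip_i$ and $Q=\sum_iQ_i$, to ensure $p(z_{\rm out})-p(z)+\langle Q(z),z_{\rm out}-z\rangle\le\epsilon n\|z_{\rm in}-z\|_{\mathbf P}^2$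 for all $z\in\mathcal C$, it is sufficient to perform no more than $6^n\max\{\sqrt{L_i/\epsilon},M_i/\epsilon,1\}$ computations of $\nabla p_i$ and $Q_i$ for each $1\le i\le n$. The corresponding choice is: write $m_i=\max\{\sqrt{L_i/\epsilon},M_i/\epsilon,1\}$, reorder the pairs $(p_i,Q_i)$ (with their constants $L_i,M_i$) so that $m_1\le m_2\le\dots\le m_n$, and set $T_1=\lceil 2m_1\rceil$ and $T_{i+1}=\lceil 2m_{i+1}/m_i\rceil$ for $i=1,\dots,n-1$. *)

(* Defs.v *)
From HB Require Import structures.
From mathcomp Require Import all_boot all_order all_algebra.
From mathcomp Require Import all_classical all_reals all_analysis.

Set Implicit Arguments.
Unset Strict Implicit.
Unset Printing Implicit Defensive.

Import Order.TTheory GRing.Theory Num.Theory.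
Import numFieldNormedType.Exports.

Local Open Scope classical_set_scope.
Local Open Scope ring_scope.

Section Euclidean.
Context {R : realType}.

Definition dot {d : nat} (u v : 'cV[R]_d) : R := \sum_i u i 0 * v i 0.

(* The library norm on matrices is the sup norm, hence a separate Euclidean
   norm; the two induce the same notion of differentiability. *)
Definition enorm {d : nat} (u : 'cV[R]_d) : R := Num.sqrt (dot u u).

(* [normP (invmx P)] is the dual norm. *)
Definition normP {d : nat} (P : 'M[R]_d) (z : 'cV[R]_d) : R :=
  Num.sqrt (dot (P *m z) z).

(* Meaningful only where [h] is differentiable. *)
Definition grad {d : nat} (h : 'cV[R]_d -> R) (x : 'cV[R]_d) : 'cV[R]_d :=
  \col_i 'D_(delta_mx i 0) h x.

Definition bregman {d : nat} (h : 'cV[R]_d -> R) (x x' : 'cV[R]_d) : R :=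
  h x - h x' - dot (grad h x') (x - x').

Definition strongly_convex {d : nat} (mu : R) (h : 'cV[R]_d -> R) : Prop :=
  forall x x', mu / 2 * enorm (x - x') ^+ 2 <= bregman h x x'.

Definition convex {d : nat} (h : 'cV[R]_d -> R) : Prop := strongly_convex 0 h.

Definition smooth {d : nat} (L : R) (h : 'cV[R]_d -> R) : Prop :=
  forall x x', `|bregman h x x'| <= L / 2 * enorm (x - x') ^+ 2.

Definition monotone_op {d : nat} (G : 'cV[R]_d -> 'cV[R]_d) : Prop :=
  forall z z', 0 <= dot (G z - G z') (z - z').

Definition lipschitz_op {d : nat} (P : 'M[R]_d) (M : R)
    (G : 'cV[R]_d -> 'cV[R]_d) : Prop :=
  forall z z', normP (invmx P) (G z - G z') <= M * normP P (z - z').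

Definition edist {d : nat} (x : 'cV[R]_d) (A : set 'cV[R]_d) : R :=
  inf [set enorm (x - x') | x' in A].

Definition is_proj {d : nat} (A : set 'cV[R]_d) (z w : 'cV[R]_d) : Prop :=
  A w /\ forall w', A w' -> enorm (z - w) <= enorm (z - w').

Definition is_argmin {d : nat} (C : set 'cV[R]_d) (F : 'cV[R]_d -> R)
    (z : 'cV[R]_d) : Prop :=
  C z /\ forall z', C z' -> F z <= F z'.

Definition argmin {d : nat} (C : set 'cV[R]_d) (F : 'cV[R]_d -> R) : 'cV[R]_d :=
  get (is_argmin C F).

(* The extremal eigenvalues live in \bar R so that an empty minimum is +oo:
   this only concerns 0 x 0 matrices and [lambda_minp] of the zero matrix. *)
Definition lambda_min {d : nat} (A : 'M[R]_d) : \bar R :=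
  ereal_inf [set l%:E | l in [set l | eigenvalue A l]].

Definition lambda_minp {d : nat} (A : 'M[R]_d) : \bar R :=
  ereal_inf [set l%:E | l in [set l | eigenvalue A l /\ 0 < l]].

Definition lambda_max {d : nat} (A : 'M[R]_d) : \bar R :=
  ereal_sup [set l%:E | l in [set l | eigenvalue A l]].

Definition fenchel {d : nat} (h : 'cV[R]_d -> R) (u : 'cV[R]_d) : \bar R :=
  ereal_sup (range (fun x => (dot u x - h x)%:E)).

End Euclidean.

Section Algorithm1.
Context {R : realType}.

Fixpoint alpha (t : nat) : R :=
  if t is s.+1 then 2 * (1 + Num.sqrt (1 + 4 / alpha s ^+ 2))^-1 else 1.

(* Families are indexed by nat, and only the entries 1, ..., n are used. *)
Context {d : nat} (n : nat) (P : 'M[R]_d) (C : set 'cV[R]_d).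
Context (p : nat -> 'cV[R]_d -> R) (Q : nat -> 'cV[R]_d -> 'cV[R]_d).
Context (L M : nat -> R) (T : nat -> nat).

(* [ts] is the list t_1, ..., t_k. *)
Definition Lcoef (i : nat) (ts : seq nat) : R :=
  L i * \prod_(1 <= l < (size ts).+1) alpha (nth 0%N ts l.-1).

Definition Mcoef (i : nat) (ts : seq nat) : R :=
  M i * \prod_(1 <= l < (size ts).+1)
          (alpha (nth 0%N ts l.-1) / alpha (T l).-1).

Definition Hcoef (i : nat) (ts : seq nat) : R := Lcoef i ts + Mcoef i ts.

(* [q] is the family of the p_i^{k-1}, [zbar] is the current average of
   level k. *)
Definition p_hat (k t : nat) (zbar : 'cV[R]_d) (q : nat -> 'cV[R]_d -> R)
    (i : nat) (z : 'cV[R]_d) : R :=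
  if (k <= i)%N
  then (alpha t)^-1 * q i (alpha t *: z + (1 - alpha t) *: zbar)
  else q i z.

Definition Delta (k t : nat) (zbar zk : 'cV[R]_d) (q : nat -> 'cV[R]_d -> R)
    (i : nat) : 'cV[R]_d :=
  grad (p_hat k t zbar q i) zk + Q i zk.

Definition p_next (k : nat) (ts : seq nat) (zbar zk : 'cV[R]_d)
    (q : nat -> 'cV[R]_d -> R) (i : nat) (z : 'cV[R]_d) : R :=
  let t := last 0%N ts in
  if i == k
  then 2^-1 * Hcoef k ts * normP P (z - zk) ^+ 2 + dot z (Delta k t zbar zk q k)
  else p_hat k t zbar q i z.

Definition set_reg (w : nat -> 'cV[R]_d) (k : nat) (v : 'cV[R]_d) :
    nat -> 'cV[R]_d :=
  fun l => if l == k then v else w l.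

(* [Rec r ts q w] is the call Rec(k; ts) with k = size ts + 1 and r = n + 1 - k
   remaining levels; [q i] is p_i^{k-1; ts}.  It returns the value of the call
   together with the updated registers.  Register [l] holds the current
   iterate z^l: on entry [w l] (l >= k) is z^l_{ts,0,...,0}.  Passing the
   registers of levels l > k from one pass of the loop to the next is exactly
   the warm start
     z^l_{t_1..t_{k-1}, t_k + 1, 0..0} = z^l_{t_1..t_k, T_{k+1}, 0..0}.
   [iteri] runs its body for t = 0, ..., T k - 1 in this order. *)
Fixpoint Rec (r : nat) (ts : seq nat) (q : nat -> 'cV[R]_d -> R)
    (w : nat -> 'cV[R]_d) {struct r} : 'cV[R]_d * (nat -> 'cV[R]_d) :=
  if r is r'.+1 then
    let k := (size ts).+1 in
    iteri (T k)
      (fun t (s : 'cV[R]_d * (nat -> 'cV[R]_d)) =>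
         let zbar := s.1 in
         let zk := s.2 k in
         let ts' := rcons ts t in
         let out := Rec r' ts' (p_next k ts' zbar zk q) s.2 in
         let zhalf := out.1 in
         (alpha t *: zhalf + (1 - alpha t) *: zbar,
          set_reg out.2 k
            (zhalf + invmx (Hcoef k ts' *: P) *m (Q k zk - Q k zhalf))))
      (w k, w)
  else (argmin C (fun z => \sum_(1 <= i < n.+1) q i z), w).

Definition algorithm1 (zin : 'cV[R]_d) : 'cV[R]_d :=
  (Rec n [::] p (fun _ => zin)).1.

End Algorithm1.

Section IterationRule.
Context {R : realType}.

Definition complexity (eps : R) (L M : nat -> R) (i : nat) : R :=
  Num.max (Num.max (Num.sqrt (L i / eps)) (M i / eps)) 1.

Definition iter_counts (m : nat -> R) (i : nat) : nat :=
  absz (Num.ceil (if i == 1%N then 2 * m 1%N else 2 * m i / m i.-1)).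

(* [s] lists 1, ..., n in an order making the complexities nondecreasing, and
   [reorder s F] is the family F taken in that order. *)
Definition sorting (n : nat) (m : nat -> R) (s : seq nat) : Prop :=
  perm_eq s (iota 1 n) /\ sorted (fun i j => m i <= m j) s.

Definition reorder {A : Type} (s : seq nat) (F : nat -> A) (i : nat) : A :=
  F (nth 0%N s i.-1).

End IterationRule.

Section SaddlePoint.
Context {R : realType}.

Record params := Params {
  Lx : R; Ly : R; Lxy : R; mux : R; muy : R; muxy : R; muyx : R }.

Definition admissible (pi : params) : Prop :=
  [/\ 0 <= mux pi < Lx pi,
      0 <= muy pi < Ly pi,
      0 <= muxy pi < Lxy pi,
      0 <= muyx pi < Lxy pi &
      0 < muxy pi -> 0 < muyx pi -> muxy pi = muyx pi].

Definition delta_x (pi : params) : R := mux pi + muxy pi ^+ 2 / Ly pi.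
Definition delta_y (pi : params) : R := muy pi + muyx pi ^+ 2 / Lx pi.
Definition kappa_x (pi : params) : R := Lx pi / delta_x pi.
Definition kappa_y (pi : params) : R := Ly pi / delta_y pi.
Definition kappa_xy (pi : params) : R :=
  Lxy pi ^+ 2 / (delta_x pi * delta_y pi).
Definition beta_x (pi : params) : R := (4 * Ly pi)^-1.
Definition beta_y (pi : params) : R := (4 * Lx pi)^-1.

Context {dx dy : nat}.
Context (B : 'M[R]_(dy, dx)) (f : 'cV[R]_dx -> R) (g : 'cV[R]_dy -> R).

Definition grad_f_in_range : Prop := forall x, range (mulmx B^T) (grad f x).
Definition grad_g_in_range : Prop := forall y, range (mulmx B) (grad g y).

Definition regular (pi : params) : Prop :=
  [/\ strongly_convex (mux pi) f /\ smooth (Lx pi) f,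
      strongly_convex (muy pi) g /\ smooth (Ly pi) g,
      (grad_f_in_range -> ((muxy pi ^+ 2)%:E <= lambda_minp (B^T *m B))%E) /\
      (~ grad_f_in_range -> ((muxy pi ^+ 2)%:E <= lambda_min (B^T *m B))%E),
      (grad_g_in_range -> ((muyx pi ^+ 2)%:E <= lambda_minp (B *m B^T))%E) /\
      (~ grad_g_in_range -> ((muyx pi ^+ 2)%:E <= lambda_min (B *m B^T))%E) &
      (lambda_max (B^T *m B) <= (Lxy pi ^+ 2)%:E)%E].

(* A pair z = (x, y) is the column [col_mx x y], with components [usubmx z]
   and [dsubmx z]. *)
Definition solutions : set 'cV[R]_(dx + dy) :=
  [set z | grad f (usubmx z) + B^T *m dsubmx z = 0 /\
           grad g (dsubmx z) - B *m usubmx z = 0].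

Definition primal (x : 'cV[R]_dx) : \bar R :=
  ((f x)%:E + fenchel g (B *m x))%E.

Definition dual (y : 'cV[R]_dy) : \bar R :=
  ((- g y)%:E - fenchel f (- (B^T *m y)))%E.

Definition primal_solutions : set 'cV[R]_dx :=
  [set x | forall x', (primal x <= primal x')%E].

Definition dual_solutions : set 'cV[R]_dy :=
  [set y | forall y', (dual y' <= dual y)%E].

Definition dist_sq (deltax deltay : R) (z : 'cV[R]_(dx + dy)) : R :=
  deltax * edist (usubmx z) primal_solutions ^+ 2 +
  deltay * edist (dsubmx z) dual_solutions ^+ 2.

Definition Psi (pi : params) (zs z : 'cV[R]_(dx + dy)) : R :=
  dist_sq (delta_x pi) (delta_y pi) z +
  12 * bregman f (usubmx z) (usubmx zs) +
  12 * bregman g (dsubmx z) (dsubmx zs).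

Definition Pmat (pi : params) : 'M[R]_(dx + dy) :=
  block_mx (delta_x pi)%:M 0 0 (delta_y pi)%:M.

Definition p_fam (pi : params) (xin : 'cV[R]_dx) (yin : 'cV[R]_dy)
    (i : nat) (z : 'cV[R]_(dx + dy)) : R :=
  match i with
  | 1 => f (usubmx z)
  | 2 => g (dsubmx z)
  | 3 => beta_x pi / 2 * enorm (B *m usubmx z - grad g yin) ^+ 2 +
         beta_y pi / 2 * enorm (B^T *m dsubmx z + grad f xin) ^+ 2
  | _ => 0
  end.

Definition Q_fam (i : nat) (z : 'cV[R]_(dx + dy)) : 'cV[R]_(dx + dy) :=
  if i == 3%N then col_mx (B^T *m dsubmx z) (- (B *m usubmx z)) else 0.

Definition L_fam (pi : params) (i : nat) : R :=
  match i with
  | 1 => kappa_x pi | 2 => kappa_y pi | 3 => kappa_xy pi | _ => 0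
  end.

Definition M_fam (pi : params) (i : nat) : R :=
  if i == 3%N then Num.sqrt (kappa_xy pi) else 0.

End SaddlePoint.

Arguments params R : clear implicits.

(* Main.v *)
(* The inner solver satisfies, for every [z],
     p(z_out) - p(z) + <Q(z), z_out - z> <= 3 eps |z_in - z|_P^2.
   This is an induction over the levels of the recursion: at each level the gap
   plus (s / 2) |. - z|_P^2, where s P is the Hessian of the levels already
   linearised, telescopes against a potential sum_l c_l |z^l - z|_P^2 in the
   warm-started iterates, because (1 - alpha_(t+1)) / alpha_(t+1)^2 = 1 / alpha_t^2
   and the weights c_l / alpha_t do not depend on t.  The iteration rule makes
   every initial weight at most eps.

   Taking z = z^* with eps = 1/72, the terms p_1, p_2, Q_3 become
   D_f(x_out, x^* ) + D_g(y_out, y^* ), while p_3 controls |B (x_out - x^* )|^2 up to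
   |grad g(y_in) - grad g(y^* )|^2 <= 2 L_y D_g(y_in, y^* ), and symmetrically in y.
   Strong convexity and the spectral bounds on B turn this into a bound on the
   distances, since all iterates stay in z_in + V, where V is the orthogonal
   complement of the directions along which the solution set can extend.

   A solution in z_in + V exists because the saddle operator, composed with a
   suitable skew linear map, is strongly monotone along V. *)

Require Import Defs.
From HB Require Import structures.
From mathcomp Require Import all_boot all_order all_algebra.
From mathcomp Require Import all_classical all_reals all_analysis.
From mathcomp Require Import ring lra.

Set Implicit Arguments.
Unset Strict Implicit.
Unset Printing Implicit Defensive.

Import Order.TTheory GRing.Theory Num.Theory.
Import numFieldNormedType.Exports.

Local Open Scope classical_set_scope.
Local Open Scope ring_scope.

(** Strong convexity may be absent altogether; the conditioning then comes from B alone, which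
    controls a displacement only up to its kernel. The term p_3 passes this conditioning to the
    algorithm, but it has to be centred at gradients taken at z_in, because those at the solution
    are unknown. The price is a pair of Bregman distances at z_in: this is why Psi contains them and
    why they must contract together with the distances. The spectral hypotheses depend on whether
    the gradients stay in the range of B^T (or of B). V absorbs this distinction: each of its two
    components is the complement of a kernel in one case and the whole space in the other, and the
    lower bound on B along V reads the same in both. Staying in z_in + V also makes a single
    solution the projection of both z_in and z_out. The accuracy is a universal constant, since the
    metric P scales x and y by delta_x and delta_y and leaves only pure numbers in the final
    estimate. *)

(** * Euclidean geometry, compactness, and gradients read off from quadratic remainders *)

Section EuclideanSpace.
Context {R : realType}.

Section Dot.
Context {d : nat}.
Implicit Types (u v w x y : 'cV[R]_d) (a : R).

Lemma dotC u v : dot u v = dot v u.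
Proof. by apply: eq_bigr => i _; rewrite mulrC. Qed.

Lemma dotDl u v w : dot (u + v) w = dot u w + dot v w.
Proof. by rewrite -big_split; apply: eq_bigr => i _; rewrite mxE mulrDl. Qed.

Lemma dotZl a u v : dot (a *: u) v = a * dot u v.
Proof. by rewrite mulr_sumr; apply: eq_bigr => i _; rewrite mxE mulrA. Qed.

Lemma dotDr u v w : dot u (v + w) = dot u v + dot u w.
Proof. by rewrite dotC dotDl !(dotC u). Qed.

Lemma dotZr a u v : dot u (a *: v) = a * dot u v.
Proof. by rewrite dotC dotZl (dotC u). Qed.

Lemma dotNl u v : dot (- u) v = - dot u v.
Proof. by rewrite -scaleN1r dotZl mulN1r. Qed.

Lemma dotNr u v : dot u (- v) = - dot u v.
Proof. by rewrite dotC dotNl dotC. Qed.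

Lemma dot0l u : dot 0 u = 0.
Proof. by rewrite -(scale0r 0) dotZl mul0r. Qed.

Lemma dot0r u : dot u 0 = 0.
Proof. by rewrite dotC dot0l. Qed.

Definition dotE := (dotDl, dotDr, dotNl, dotNr, dotZl, dotZr, dot0l, dot0r).

Lemma dot_ge0 u : 0 <= dot u u.
Proof. by apply: sumr_ge0 => i _; rewrite -expr2 sqr_ge0. Qed.

Lemma dot_eq0 u : (dot u u == 0) = (u == 0).
Proof.
apply/eqP/eqP => [u0|->]; last exact: dot0l.
apply/colP => i; rewrite mxE; apply/eqP; rewrite -sqrf_eq0 expr2.
move/eqP: u0; rewrite psumr_eq0 => [/allP/(_ i)|j _].
  by rewrite mem_index_enum => /(_ isT).
by rewrite -expr2 sqr_ge0.
Qed.

Lemma dot_le0 u : dot u u <= 0 -> u = 0.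
Proof. by move=> u0; apply/eqP; rewrite -dot_eq0 eq_le u0 dot_ge0. Qed.

Lemma enorm_ge0 u : 0 <= enorm u.
Proof. exact: sqrtr_ge0. Qed.

Lemma enorm2 u : enorm u ^+ 2 = dot u u.
Proof. by rewrite sqr_sqrtr ?dot_ge0. Qed.

Lemma enorm_le u v : (enorm u <= enorm v) = (dot u u <= dot v v).
Proof. by rewrite ler_sqrt ?dot_ge0. Qed.

Lemma dot_young a u v : 0 < a ->
  2 * dot u v <= a * dot u u + a^-1 * dot v v.
Proof.
move=> a0; have := dot_ge0 (a *: u - v).
rewrite !dotE (dotC v u) => h.
have : 0 <= a^-1 * (a * (a * dot u u) - 2 * a * dot u v + dot v v).
  by apply: mulr_ge0; [rewrite invr_ge0 ltW | lra].
rewrite mulrDr mulrBr !mulrA -(mulrA _ 2) mulVf ?gt_eqF // (mulrC _ (2 * a)).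
rewrite -(mulrA 2) mulfV ?gt_eqF //; lra.
Qed.

Lemma dotD_le u v : dot (u + v) (u + v) <= 2 * dot u u + 2 * dot v v.
Proof. by have := dot_ge0 (u - v); rewrite !dotE (dotC v u); lra. Qed.

Lemma dot_le_enorm u v : dot u v <= enorm u * enorm v.
Proof.
have [v0|v0] := eqVneq v 0; first by rewrite v0 dot0r mulr_ge0 ?enorm_ge0.
have [u0|u0] := eqVneq u 0; first by rewrite u0 dot0l mulr_ge0 ?enorm_ge0.
have pos w : w != 0 -> 0 < enorm w.
  by move=> w0; rewrite sqrtr_gt0 lt_def dot_eq0 w0 dot_ge0.
have := dot_young u v (divr_gt0 (pos _ v0) (pos _ u0)).
rewrite -!enorm2 invf_div.
have -> : enorm v / enorm u * enorm u ^+ 2 + enorm u / enorm v * enorm v ^+ 2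
          = 2 * (enorm u * enorm v).
  by field; rewrite !gt_eqF ?pos.
by lra.
Qed.

Lemma enormD u v : enorm (u + v) <= enorm u + enorm v.
Proof.
rewrite -ler_sqr ?nnegrE ?addr_ge0 ?enorm_ge0 // enorm2 !dotE (dotC v u).
have := dot_le_enorm u v; rewrite -!enorm2; nra.
Qed.

Lemma enormN u : enorm (- u) = enorm u.
Proof. by rewrite /enorm dotNl dotNr opprK. Qed.

Lemma enorm_dist u v : `|enorm u - enorm v| <= enorm (u - v).
Proof.
have := enormD (u - v) v; have := enormD (v - u) u.
by rewrite !subrK -(enormN (v - u)) opprB ler_norml => h1 h2; lra.
Qed.

Lemma coord_le_enorm u i : `|u i 0| <= enorm u.
Proof.
rewrite -sqrtr_sqr ler_sqrt ?dot_ge0 // /dot (bigD1 i) //= -expr2 lerDl.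
by apply: sumr_ge0 => j _; rewrite -expr2 sqr_ge0.
Qed.

Lemma norm_le_enorm u : `|u| <= enorm u.
Proof.
rewrite [`|u|]mx_normrE; apply/bigmax_leP; split; first exact: enorm_ge0.
by move=> [i j] _ /=; rewrite ord1 coord_le_enorm.
Qed.

Lemma dot_le_norm u : dot u u <= d%:R * `|u| ^+ 2.
Proof.
have -> : d%:R * `|u| ^+ 2 = \sum_(i < d) `|u| ^+ 2.
  by rewrite sumr_const card_ord mulr_natl.
apply: ler_sum => i _; rewrite -expr2 -[leLHS]real_normK ?num_real //.
rewrite ler_sqr ?nnegrE // [leRHS]mx_normrE.
by apply: le_trans (le_bigmax _ _ (i, 0)).
Qed.

End Dot.

Lemma dot_mxE {d} (u v : 'cV[R]_d) : dot u v = (u^T *m v) 0 0.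
Proof. by rewrite mxE; apply: eq_bigr => i _; rewrite mxE. Qed.

Lemma dot_mull {m d} (A : 'M[R]_(m, d)) u v : dot (A *m u) v = dot u (A^T *m v).
Proof. by rewrite !dot_mxE trmx_mul mulmxA. Qed.

Lemma dot_mulr {m d} (A : 'M[R]_(m, d)) u v : dot u (A *m v) = dot (A^T *m u) v.
Proof. by rewrite dot_mull trmxK. Qed.

Lemma dot_col {m d} (u u' : 'cV[R]_m) (v v' : 'cV[R]_d) :
  dot (col_mx u v) (col_mx u' v') = dot u u' + dot v v'.
Proof. by rewrite !dot_mxE tr_col_mx mul_row_col mxE. Qed.

Lemma dot_split {m d} (z z' : 'cV[R]_(m + d)) :
  dot z z' = dot (usubmx z) (usubmx z') + dot (dsubmx z) (dsubmx z').
Proof. by rewrite -dot_col !vsubmxK. Qed.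

Lemma cV_EVT_min {d} (h : 'cV[R]_d -> R) (A : set 'cV[R]_d) M :
  continuous h -> closed A -> A !=set0 -> (forall x, A x -> enorm x <= M) ->
  exists2 x, A x & forall y, A y -> h x <= h y.
Proof.
move=> ch cA [a Aa] bA.
have ctr : continuous (fun v : 'rV[R]_d => v^T).
  move=> v U /= /nbhs_ballP[e e0 eU]; apply/nbhs_ballP; exists e => // w.
  move=> [_ vw]; apply: eU; split=> // i j; rewrite !mxE; exact: vw.
have [|||x] := @EVT_min_rV R d (fun v => h v^T) [set v | A v^T].
- by exists a^T; rewrite /= trmxK.
- apply: bounded_closed_compact.
    exists M; split; first exact: num_real.
    move=> N MN v Av; apply: le_trans (ltW MN); apply: le_trans (bA _ Av).
    apply: le_trans (norm_le_enorm _).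
    rewrite [leLHS]mx_normrE; apply/bigmax_leP; split=> // -[i j] _ /=.
    rewrite [leRHS]mx_normrE; apply: le_trans (le_bigmax _ _ (j, i)).
    by rewrite /= mxE.
  by apply: preimage_closed => // v _; exact: ctr.
- apply: continuous_subspaceT => v.
  exact: (@continuous_comp _ _ _ (fun v : 'rV[R]_d => v^T) h v (ctr v) (ch _)).
rewrite inE /= => Ax xmin; exists x^T => // y Ay.
by have := xmin y^T; rewrite trmxK; apply; rewrite inE /= trmxK.
Qed.

Lemma lipschitz_continuous_cV {d} (h : 'cV[R]_d -> R) K :
  (forall x y, `|h x - h y| <= K * enorm (x - y)) -> continuous h.
Proof.
move=> hK x.
apply/(@cvgrPdist_le _ _ _ (nbhs x) _ h (h x)) => e e0.
pose K' := `|K| * Num.sqrt d%:R + 1.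
have K'0 : 0 < K' by rewrite ltr_pwDr // mulr_ge0 ?sqrtr_ge0.
near=> y.
have xy : enorm (x - y) <= Num.sqrt d%:R * `|x - y|.
  rewrite -[X in _ * X]ger0_norm // -sqrtr_sqr -sqrtrM // ler_sqrt ?sqr_ge0 //.
  exact: dot_le_norm.
have : `|x - y| < e / K'.
  by near: y; apply: cvgr_dist_lt; rewrite ?divr_gt0.
rewrite ltr_pdivlMr // => /ltW; apply: le_trans.
apply: le_trans (hK x y) _; apply: (@le_trans _ _ (`|K| * enorm (x - y))).
  by rewrite ler_wpM2r ?enorm_ge0 // ler_norm.
apply: (@le_trans _ _ (`|K| * (Num.sqrt d%:R * `|x - y|))).
  by rewrite ler_wpM2l.
by rewrite mulrA mulrC ler_wpM2l // lerDl.
Unshelve. all: by end_near.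
Qed.

Lemma dot_continuousl {d} (u : 'cV[R]_d) : continuous (fun x => dot x u).
Proof.
apply: (@lipschitz_continuous_cV _ _ (enorm u)) => x y.
rewrite -dotNl -dotDl ler_norml mulrC dot_le_enorm andbT lerNl -dotNl.
by rewrite -[leRHS]/(enorm _ * _) -(enormN (x - y)) dot_le_enorm.
Qed.

Lemma sum_continuous {T : topologicalType} (I : Type) (r : seq I)
    (F : I -> T -> R) :
  (forall i, continuous (F i)) -> continuous (fun x => \sum_(i <- r) F i x).
Proof.
move=> cF; elim: r => [|i r IH] x.
  by under eq_fun do rewrite big_nil; exact: cst_continuous.
under eq_fun do rewrite big_cons.
exact: continuousD (cF i x) (IH x).
Qed.

Lemma quadratic_form_continuous {d} (A : 'M[R]_d) :
  continuous (fun x => dot (A *m x) x).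
Proof.
have cA i : continuous (fun x : 'cV[R]_d => (A *m x) i 0).
  under eq_fun do rewrite mxE.
  apply: sum_continuous => j y; apply: continuousM; first exact: cst_continuous.
  exact: coord_continuous.
apply: sum_continuous => i x; apply: continuousM; first exact: cA.
exact: coord_continuous.
Qed.

(** A remainder of second order is a little-o of the displacement, so G is the differential.
    Gradients of rescaled and quadratic functions are obtained in this way from the inequalities
    that are needed anyway. *)
Lemma quadratic_remainder_grad {d} (h : 'cV[R]_d -> R) (x G : 'cV[R]_d) K :
  (forall y, `|h y - h x - dot G (y - x)| <= K * dot (y - x) (y - x)) ->
  differentiable h x /\ grad h x = G.
Proof.
move=> hK.
have @df : {linear 'cV[R]_d -> R}.
  exists (dot G); do 2![eexists]; do ?[constructor].
  - exact: dot0r.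
  - exact: dotDr.
  - by move=> a u; rewrite dotZr.
have cdf : continuous df.
  have := @dot_continuousl d G; rewrite (_ : (fun u => dot u G) = df) //.
  by apply/funext => u; exact: dotC.
have dfo : h \o shift x = cst (h x) + df +o_ (0 : 'cV[R]_d) id.
  apply/(@eqaddoP R 'cV[R]_d R 'cV[R]_d) => e e0.
  have K1 : 0 < `|K| * d%:R + 1 by rewrite ltr_pwDr // mulr_ge0.
  have eK : 0 < e / (`|K| * d%:R + 1) by rewrite divr_gt0.
  near=> v; rewrite !fctE /=.
  have ve : `|v| <= e / (`|K| * d%:R + 1).
    by near: v; rewrite nbhs_simpl /=; exact: (@nbhs0_le R 'cV[R]_d _ eK).
  have := hK (v + x); rewrite addrK opprD addrA => /le_trans; apply.
  have Kv : dot v v <= d%:R * `|v| ^+ 2 := dot_le_norm v.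
  apply: (@le_trans _ _ (`|K| * dot v v)).
    by rewrite ler_wpM2r ?dot_ge0 ?ler_norm.
  apply: (@le_trans _ _ (`|K| * (d%:R * `|v| ^+ 2))); first by rewrite ler_wpM2l.
  rewrite expr2 !mulrA ler_wpM2r //; move: ve; rewrite ler_pdivlMr // => ve.
  by apply: le_trans ve; rewrite mulrC ler_wpM2l // lerDl.
have dE := diff_unique cdf dfo.
have hd : differentiable h x by apply/diff_locallyP; rewrite dE.
split=> //; apply/colP => i; rewrite mxE deriveE // dE /= /dot (bigD1 i) //=.
rewrite mxE !eqxx mulr1 big1 ?addr0 // => j /negPf ji.
by rewrite mxE ji mulr0.
Unshelve. all: by end_near.
Qed.

End EuclideanSpace.

(** * Positive definite metrics, cocoercivity, and Rayleigh quotients *)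

Section PositiveDefinite.
Context {R : realType} {d : nat}.
Implicit Types (P : 'M[R]_d) (h : 'cV[R]_d -> R).

Definition posdef P : Prop :=
  P^T = P /\ forall u, u != 0 -> 0 < dot (P *m u) u.

Lemma posdef_ge0 P u : posdef P -> 0 <= dot (P *m u) u.
Proof.
by move=> [_ Ppos]; have [->|/Ppos/ltW//] := eqVneq u 0; rewrite dot0r.
Qed.

Lemma posdef_unitmx P : posdef P -> P \in unitmx.
Proof.
move=> [_ Ppos]; rewrite -row_full_unit /row_full eqn_leq rank_leq_col -subn_eq0 /=.
rewrite -mxrank_coker mxrank_eq0; apply/eqP/matrixP => i j; rewrite mxE.
have Pc : P *m col j (cokermx P) = 0 by rewrite colE mulmxA mulmx_coker mul0mx.
have [c0|/Ppos] := eqVneq (col j (cokermx P)) 0; last by rewrite Pc dot0l ltxx.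
by have := congr1 (fun u : 'cV_d => u i 0) c0; rewrite !mxE.
Qed.

Lemma posdef_dotC P u v : posdef P -> dot (P *m u) v = dot (P *m v) u.
Proof. by move=> [PT _]; rewrite dot_mull PT dotC. Qed.

Lemma posdef_inv_ge0 P u : posdef P -> 0 <= dot (invmx P *m u) u.
Proof.
move=> Ppos; have Pu := posdef_unitmx Ppos.
by rewrite -{2}(mulKVmx Pu u) dotC posdef_ge0.
Qed.

Lemma normP2 P u : posdef P -> normP P u ^+ 2 = dot (P *m u) u.
Proof. by move=> Ppos; rewrite sqr_sqrtr // posdef_ge0. Qed.

Lemma normP_inv2 P u : posdef P ->
  normP (invmx P) u ^+ 2 = dot (invmx P *m u) u.
Proof. by move=> Ppos; rewrite sqr_sqrtr // posdef_inv_ge0. Qed.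

Lemma posdef1 : posdef 1%:M.
Proof.
by split=> [|u u0]; rewrite ?trmx1 // mul1mx lt_def dot_eq0 u0 dot_ge0.
Qed.

Lemma bregman_sym h x x' :
  bregman h x x' + bregman h x' x = dot (grad h x - grad h x') (x - x').
Proof. by rewrite /bregman -(opprB x x') !dotE; lra. Qed.

(* The left-hand side comes from minimising over [y] the quadratic upper model
   of [h] at [x'] minus its linear lower model at [x]. *)
Lemma cocoercive P L h x x' : posdef P -> 0 < L ->
  (forall y, 0 <= bregman h y x) ->
  (forall y, bregman h y x' <= L / 2 * normP P (y - x') ^+ 2) ->
  (2 * L)^-1 * normP (invmx P) (grad h x' - grad h x) ^+ 2 <= bregman h x' x.
Proof.
move=> Ppos L0 hcvx hsmooth; have Pu := posdef_unitmx Ppos.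
have [w wE] : exists w, grad h x' - grad h x = w by exists (grad h x' - grad h x).
have gE : grad h x' = w + grad h x by rewrite -wE subrK.
pose y := x' - L^-1 *: (invmx P *m w).
have yx' : y - x' = - (L^-1 *: (invmx P *m w)) by rewrite /y addrAC subrr add0r.
have yx : y - x = - (L^-1 *: (invmx P *m w)) + (x' - x).
  by rewrite -yx' addrA subrK.
have := hsmooth y; have := hcvx y.
rewrite wE normP2 // normP_inv2 // /bregman yx' yx gE.
rewrite mulmxN -scalemxAr mulKVmx // !dotE (dotC w).
set q := dot (invmx P *m w) w; set r := dot (grad h x) (invmx P *m w).
move=> h1 h2.
have -> : (2 * L)^-1 * q = L^-1 * q / 2 by field; rewrite gt_eqF.
have : L / 2 * - - (L^-1 * (L^-1 * q)) = L^-1 * q / 2.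
  by field; rewrite gt_eqF.
lra.
Qed.

Lemma bregman_monotone h :
  (forall x y, 0 <= bregman h x y) -> monotone_op (grad h).
Proof. by move=> hcvx z z'; rewrite -bregman_sym addr_ge0. Qed.

Lemma bregman_lipschitz P L h : posdef P -> 0 < L ->
  (forall x y, 0 <= bregman h x y) ->
  (forall x y, bregman h x y <= L / 2 * normP P (x - y) ^+ 2) ->
  lipschitz_op P L (grad h).
Proof.
move=> Ppos L0 hcvx hsmooth z z'.
rewrite -ler_sqr ?nnegrE ?mulr_ge0 ?sqrtr_ge0 ?(ltW L0) // exprMn.
have := @cocoercive _ _ h z' z Ppos L0 (hcvx ^~ z') (hsmooth ^~ z).
move/le_trans/(_ (hsmooth z z')).
rewrite mulrC ler_pdivrMr ?mulr_gt0 //; lra.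
Qed.

End PositiveDefinite.

(** The Rayleigh quotient attains its minimum on the unit sphere of V by compactness, and invariance
    of V makes the eigenvector residual an admissible direction. The subspace V is a parameter so
    that the smallest positive eigenvalue is reached as a minimum over the complement of a
    kernel. *)
Lemma symmetric_min_eigenvalue {R : realType} {d} (A : 'M[R]_d)
    (V : set 'cV[R]_d) :
  A^T = A -> closed V -> (forall a u v, V u -> V v -> V (a *: u + v)) ->
  (forall u, V u -> V (A *m u)) -> (exists2 u, V u & u != 0) ->
  exists l v, [/\ V v, v != 0, A *m v = l *: v &
    forall x, V x -> l * dot x x <= dot (A *m x) x].
Proof.
move=> AT cV linV AV [u0 Vu0 u0n0].
have pos (u : 'cV[R]_d) : u != 0 -> 0 < enorm u.
  by move=> un0; rewrite sqrtr_gt0 lt_def dot_eq0 un0 dot_ge0.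
have V0 : V 0 by rewrite -(subrr u0) addrC -scaleN1r; exact: linV.
have ZV a u : V u -> V (a *: u) by move=> Vu; rewrite -[_ *: _]addr0; exact: linV.
have c1 : closed [set u : 'cV[R]_d | dot u u = 1].
  have := @quadratic_form_continuous R d 1%:M.
  rewrite (_ : (fun x => _) = fun x => dot x x); last first.
    by apply/funext => x; rewrite mul1mx.
  move=> c; apply: (@preimage_closed _ _ (fun u : 'cV[R]_d => dot u u) [set 1]).
    by move=> u _; exact: c.
  exact: closed_eq.
have unit_n0 (u : 'cV[R]_d) : dot u u = 1 -> u != 0.
  by move=> u1; apply/eqP => u0'; move: u1; rewrite u0' dot0l => /esym/eqP; rewrite oner_eq0.
have unitv (u : 'cV[R]_d) : u != 0 -> dot ((enorm u)^-1 *: u) ((enorm u)^-1 *: u) = 1.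
  by move=> un0; rewrite !dotE -enorm2; field; rewrite gt_eqF ?pos.
have [|||v [Vv v1] vmin] := @cV_EVT_min R d (fun x => dot (A *m x) x)
    (V `&` [set u | dot u u = 1]) 1 (@quadratic_form_continuous R d A).
- exact: closedI.
- by exists ((enorm u0)^-1 *: u0); split; [exact: ZV | exact: unitv].
- by move=> x [_ x1]; rewrite /enorm x1 sqrtr1.
set l := dot (A *m v) v in vmin.
have lmin x : V x -> l * dot x x <= dot (A *m x) x.
  move=> Vx; have [->|xn0] := eqVneq x 0; first by rewrite !dot0r mulr0.
  have := vmin _ (conj (ZV (enorm x)^-1 _ Vx) (unitv _ xn0)).
  rewrite -scalemxAr !dotE mulrA -expr2 exprVn mulrC ler_pdivlMr ?exprn_gt0 ?pos //.
  by rewrite enorm2.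
exists l, v; split=> //; first exact: unit_n0.
have [r rE] : exists r, r = A *m v - l *: v by eexists.
have Vr : V r by rewrite rE addrC -scaleNr; apply: linV; last exact: AV.
(* First-order optimality at [v] in the direction of the residual [r]. *)
suff r0 : dot r r <= 0 by apply/eqP; rewrite -subr_eq0 -rE (dot_le0 r0).
have quad t : 0 <= 2 * t * dot r r + t ^+ 2 * (dot (A *m r) r - l * dot r r).
  have := lmin _ (linV t _ _ Vr Vv).
  rewrite mulmxDr -scalemxAr !dotE (dotC v r) v1.
  rewrite [dot (A *m r) v]dot_mull AT (dotC r (A *m v)).
  have : dot r r = dot (A *m v) r - l * dot v r by rewrite {1}rE !dotE.
  rewrite (dotC r v) => ->; rewrite -/l; lra.
set c := dot (A *m r) r - l * dot r r in quad.
rewrite leNgt; apply/negP => rr0.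
(* A step short enough for the quadratic term to cost at most half of the linear decrease, so that
   [quad (- s)] is contradictory. *)
pose s := dot r r / (`|c| + 1).
have c1' : 0 < `|c| + 1 by rewrite ltr_pwDr.
have s0 : 0 < s by rewrite divr_gt0.
have sc : s * c <= dot r r.
  rewrite /s -mulrA ler_piMr // ?(ltW rr0) // mulrC ler_pdivrMr // mul1r.
  by rewrite (le_trans (ler_norm c)) // lerDl.
have := quad (- s); nra.
Qed.

(** * The extrapolation weights alpha *)

Section Alpha.
Context {R : realType}.
Local Notation alpha := (@alpha R).

Lemma alpha_gt0 t : 0 < alpha t.
Proof.
case: t => [|t] /=; first exact: ltr01.
by rewrite mulr_gt0 ?invr_gt0 // ltr_pwDl // sqrtr_ge0.
Qed.

(** The inverse of [alpha t.+1] is half of 1 plus the root; dropping the 1 under the root leaves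
    exactly this bound. Both the decay like 2 / (t + 2) and the monotonicity follow from it. *)
Lemma alpha_inv_step t : (alpha t)^-1 + 2^-1 <= (alpha t.+1)^-1.
Proof.
have a0 := alpha_gt0 t; rewrite /= invfM invrK.
have : 2 / alpha t <= Num.sqrt (1 + 4 / alpha t ^+ 2).
  rewrite -[leLHS]ger0_norm ?divr_ge0 ?(ltW a0) // -sqrtr_sqr ler_sqrt.
    by rewrite expr_div_n -natrX lerDr.
  by rewrite addr_ge0 // divr_ge0 // exprn_ge0 // ltW.
lra.
Qed.

Lemma alpha_recurrence t :
  (1 - alpha t.+1) / alpha t.+1 ^+ 2 = (alpha t ^+ 2)^-1.
Proof.
have a0 := alpha_gt0 t; rewrite [alpha t.+1]/=.
set s := Num.sqrt _.
have s2 : s ^+ 2 = 1 + 4 / alpha t ^+ 2.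
  by rewrite sqr_sqrtr // addr_ge0 // divr_ge0 // exprn_ge0 // ltW.
have s1 : 0 < 1 + s by rewrite ltr_pwDl // sqrtr_ge0.
have -> : (1 - 2 / (1 + s)) / (2 / (1 + s)) ^+ 2 = (s ^+ 2 - 1) / 4.
  by field; rewrite gt_eqF.
by rewrite s2; field; rewrite gt_eqF.
Qed.

Lemma alpha_le t : alpha t <= 2 / t.+2%:R.
Proof.
suff h : t.+2%:R / 2 <= (alpha t)^-1.
  by rewrite -[alpha t]invrK -[2 / _]invf_div lef_pV2 ?posrE ?invr_gt0 ?alpha_gt0.
elim: t => [|t IH]; first by rewrite /= invr1 divff.
by apply: le_trans (alpha_inv_step t); rewrite -natr1; lra.
Qed.

Lemma alpha_le1 t : alpha t <= 1.
Proof.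
by apply: le_trans (alpha_le t) _; rewrite ler_pdivrMr // mul1r ler_nat.
Qed.

Lemma alpha_nonincreasing : {homo alpha : s t / (s <= t)%N >-> t <= s}.
Proof.
apply: homo_leq => [//|s t u h1 h2|t]; first exact: le_trans h2 h1.
rewrite -lef_pV2 ?posrE ?alpha_gt0 //.
by apply: le_trans (alpha_inv_step t); rewrite lerDl.
Qed.

End Alpha.

(** * Convex smooth functions in the metric P, and one extragradient step *)

Section ConvexSmooth.
Context {R : realType} {d : nat}.
Implicit Types (P : 'M[R]_d) (q : 'cV[R]_d -> R) (u v x y z : 'cV[R]_d).

Definition sqn P u : R := dot (P *m u) u.

Definition convex_smooth P K q : Prop :=
  forall x y, 0 <= bregman q x y <= K / 2 * sqn P (x - y).

Lemma sqnD P u v : posdef P ->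
  sqn P (u + v) = sqn P u + 2 * dot (P *m u) v + sqn P v.
Proof.
by move=> Ppos; rewrite /sqn mulmxDr !dotE (posdef_dotC v u Ppos); lra.
Qed.

Lemma sqnZ P a u : sqn P (a *: u) = a ^+ 2 * sqn P u.
Proof. by rewrite /sqn -scalemxAr !dotE mulrA. Qed.

Lemma sqnN P u : sqn P (- u) = sqn P u.
Proof. by rewrite /sqn mulmxN !dotE opprK. Qed.

Lemma sqnBC P u v : sqn P (u - v) = sqn P (v - u).
Proof. by rewrite -sqnN opprB. Qed.

Lemma sqn_ge0 P u : posdef P -> 0 <= sqn P u.
Proof. exact: posdef_ge0. Qed.

Lemma sqn_convex P a u v : posdef P -> 0 <= a <= 1 ->
  sqn P (a *: u + (1 - a) *: v) <= a * sqn P u + (1 - a) * sqn P v.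
Proof.
move=> Ppos /andP[a0 a1].
have uv0 := sqn_ge0 (u - v) Ppos.
have h : 0 <= a * (1 - a) * sqn P (u - v) by rewrite !mulr_ge0 ?subr_ge0.
move: h; rewrite !sqnD // !sqnZ sqnN -!scalemxAr !dotE; lra.
Qed.

Lemma sqn_le_dot P : posdef P -> exists2 K, 0 <= K & forall u, sqn P u <= K * dot u u.
Proof.
(* The extremal eigenvalue needs a nonzero vector, so dimension 0 is set apart. The largest
   eigenvalue of P is minus the smallest one of - P. *)
move=> Ppos; have [allzero|/existsNP[u0 /eqP u0n0]] := pselect (forall u : 'cV[R]_d, u = 0).
  by exists 0 => // u; rewrite (allzero u) /sqn !dot0r mulr0.
have [|||||l [v [_ v0 _ lmin]]] := @symmetric_min_eigenvalue R d (- P) setT => //.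
- by rewrite linearN /= Ppos.1.
- by exists u0.
exists `|l| => // u; have := lmin u I; rewrite mulNmx dotNl -/(sqn P u).
have := ler_norm (- l); rewrite normrN; have := dot_ge0 u; nra.
Qed.

Lemma convex_smooth_convex P K q a x y : convex_smooth P K q -> 0 <= a <= 1 ->
  q (a *: x + (1 - a) *: y) <= a * q x + (1 - a) * q y.
Proof.
move=> qcs /andP[a0 a1]; have [u uE] : exists u, u = a *: x + (1 - a) *: y by eexists.
have /andP[+ _] := qcs x u; have /andP[+ _] := qcs y u; rewrite -uE.
rewrite /bregman => hy hx.
have h0 : a * dot (grad q u) (x - u) + (1 - a) * dot (grad q u) (y - u) = 0.
  rewrite -!dotZr -dotDr !scalerBr addrACA -opprD -scalerDl [a + _]addrC.
  by rewrite subrK scale1r -uE subrr dot0r.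
have : 0 <= a * (q x - q u - dot (grad q u) (x - u)) by rewrite mulr_ge0.
have : 0 <= (1 - a) * (q y - q u - dot (grad q u) (y - u)).
  by rewrite mulr_ge0 // subr_ge0.
move: h0; lra.
Qed.

Lemma remainder_grad P K q x g : posdef P ->
  (forall y, 0 <= q y - q x - dot g (y - x) <= K * sqn P (y - x)) ->
  differentiable q x /\ grad q x = g.
Proof.
move=> Ppos qg; have [C C0 PC] := sqn_le_dot Ppos.
apply: (@quadratic_remainder_grad _ _ _ _ _ (`|K| * C)) => y.
have /andP[h0 h1] := qg y; rewrite ger0_norm //; apply: le_trans h1 _.
rewrite -mulrA; apply: (@le_trans _ _ (`|K| * sqn P (y - x))).
  by rewrite ler_wpM2r ?sqn_ge0 ?ler_norm.
by rewrite ler_wpM2l.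
Qed.

(** The substitution in [p_hat] leaves gradients unchanged at corresponding points and multiplies
    the smoothness constant by a. This is the origin of the product of alphas in [Lcoef]. *)
Lemma rescale_remainder P K q a v x y : posdef P -> 0 < a ->
  convex_smooth P K q ->
  0 <= a^-1 * q (a *: y + v) - a^-1 * q (a *: x + v) - dot (grad q (a *: x + v)) (y - x)
    <= (a * K) / 2 * sqn P (y - x).
Proof.
move=> Ppos a0 qcs; have := qcs (a *: y + v) (a *: x + v).
rewrite /bregman.
have -> : a *: y + v - (a *: x + v) = a *: (y - x).
  by rewrite opprD addrACA subrr addr0 scalerBr.
rewrite sqnZ dotZr; set g := dot _ _; set Y := q _; set X := q _.
have -> : a^-1 * Y - a^-1 * X - g = a^-1 * (Y - X - a * g).
  by field; rewrite gt_eqF.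
move=> /andP[h1 h2]; rewrite mulr_ge0 ?invr_ge0 ?(ltW a0) //=.
by rewrite ler_pdivrMl //; lra.
Qed.

Lemma rescale_grad P K q a v x : posdef P -> 0 < a -> convex_smooth P K q ->
  grad (fun z => a^-1 * q (a *: z + v)) x = grad q (a *: x + v).
Proof.
move=> Ppos a0 qcs; apply: (remainder_grad Ppos _).2 => y.
exact: rescale_remainder.
Qed.

Lemma rescale_convex_smooth P K q a v : posdef P -> 0 < a ->
  convex_smooth P K q ->
  convex_smooth P (a * K) (fun z => a^-1 * q (a *: z + v)).
Proof.
move=> Ppos a0 qcs x y.
by rewrite /bregman (rescale_grad _ _ Ppos a0 qcs) rescale_remainder.
Qed.

(** The right-hand side is the gap between z1 and z of the surrogate H/2 |. - z0|_P^2 + <., grad q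
    z0 + Q z0>, increased by H/2 |z1 - z|_P^2. That is what the inner level bounds, and here it is
    turned into a bound on the true gap. The correction leading to z2 pays for evaluating Q at z0
    instead of z1. *)
Lemma extragradient_step P K M M' H q Q z0 z1 z2 z : posdef P -> 0 < H ->
  0 <= K -> 0 <= M <= M' -> H = K + M' -> convex_smooth P K q ->
  monotone_op Q -> lipschitz_op P M Q ->
  z2 = z1 + invmx (H *: P) *m (Q z0 - Q z1) ->
  q z1 - q z + dot (Q z) (z1 - z) + H / 2 * (sqn P (z2 - z) - sqn P (z0 - z))
  <= H / 2 * sqn P (z1 - z0) - H / 2 * sqn P (z - z0)
     + dot (z1 - z) (grad q z0 + Q z0) + H / 2 * sqn P (z1 - z).
Proof.
move=> Ppos H0 K0 /andP[M0 MM'] HE qcs Qmon Qlip z2E.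
have Pu := posdef_unitmx Ppos.
have /andP[_ h1] := qcs z1 z0; have /andP[h2 _] := qcs z z0.
have h3 := Qmon z1 z.
have [w wE] : exists w, w = Q z0 - Q z1 by eexists.
have w2 : dot (invmx P *m w) w <= M ^+ 2 * sqn P (z1 - z0).
  rewrite wE -normP_inv2 // sqnBC -[sqn _ _]normP2 // -exprMn.
  by rewrite ler_sqr ?nnegrE ?mulr_ge0 ?sqrtr_ge0.
have -> : z2 - z = (z1 - z) + H^-1 *: (invmx P *m w).
  rewrite z2E -wE invmxZ ?unitmxZ ?unitfE ?gt_eqF // -scalemxAl addrAC //.
rewrite sqnD // sqnZ dotZr dot_mulr.
have -> : (invmx P)^T *m (P *m (z1 - z)) = z1 - z.
  by rewrite trmx_inv Ppos.1 mulKmx.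
have -> : sqn P (invmx P *m w) = dot (invmx P *m w) w.
  by rewrite /sqn mulKVmx // dotC.
set W := dot (invmx P *m w) w in w2 *.
have -> : H / 2 * (sqn P (z1 - z) + 2 * (H^-1 * dot (z1 - z) w) + H^-1 ^+ 2 * W
            - sqn P (z0 - z)) =
  H / 2 * sqn P (z1 - z) + dot (z1 - z) w + W / (2 * H) - H / 2 * sqn P (z0 - z).
  by field; rewrite gt_eqF.
(* The cost of the correction fits into the M' part of H, because M^2 <= M'^2 <= M' (K + M') = M'
   H. *)
have h4 : W / (2 * H) <= M' / 2 * sqn P (z1 - z0).
  rewrite ler_pdivrMr ?mulr_gt0 //; apply: le_trans w2 _.
  have -> : M' / 2 * sqn P (z1 - z0) * (2 * H) = M' * H * sqn P (z1 - z0) by field.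
  have M'0 := le_trans M0 MM'; have M'K := mulr_ge0 M'0 K0.
  have M2 : M ^+ 2 <= M' ^+ 2 by rewrite ler_sqr.
  apply: ler_wpM2r; first exact: sqn_ge0.
  by rewrite HE; lra.
have -> : H / 2 * sqn P (z1 - z0)
  = K / 2 * sqn P (z1 - z0) + M' / 2 * sqn P (z1 - z0) by rewrite HE; field.
rewrite (sqnBC P z z0) wE.
move: h1 h2 h3; rewrite /bregman !dotE !(dotC z1) !(dotC z); lra.
Qed.

End ConvexSmooth.

(** * The recursion: gap estimate and confinement of the iterates to zin + V *)

Section Sliding.
Context {R : realType} {d n : nat} (P : 'M[R]_d) (Q : nat -> 'cV[R]_d -> 'cV[R]_d).
Context (L M : nat -> R) (T : nat -> nat) (V : set 'cV[R]_d) (zin : 'cV[R]_d).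
Context (Ppos : posdef P).
Context (n_gt0 : (0 < n)%N).
Context (T_gt0 : forall i, (1 <= i <= n)%N -> (0 < T i)%N).
Context (LM_ge0 : forall i, (1 <= i <= n)%N -> [/\ 0 <= L i, 0 <= M i & 0 < L i + M i]).
Context (Q_mon : forall i, (1 <= i <= n)%N -> monotone_op (Q i)).
Context (Q_lip : forall i, (1 <= i <= n)%N -> lipschitz_op P (M i) (Q i)).
Context (V0 : V 0).
Context (V_lin : forall a u v, V u -> V v -> V (a *: u + v)).
Context (V_P : forall u, V u -> V (P *m u)).
Context (V_Pinv : forall u, V u -> V (invmx P *m u)).
Context (V_Q : forall i z, (1 <= i <= n)%N -> V (Q i z)).

Local Notation alpha := (@alpha R).
Local Notation al ts := (\prod_(t <- ts) alpha t).
Local Notation a j := (alpha (T j).-1).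

(** The part of level l's own [Hcoef] that no loop counter affects: all the alphas at the current
    counters factor out as [al ts]. *)
Definition step_const l : R := L l + M l / \prod_(1 <= j < l.+1) a j.

(* The weight of [|z^l - z|_P^2] in the potential is [al ts * warm_weight l k]
   on entry to level [k]; each loop of level [k] gains the factor [a k ^+ 2]. *)
Definition warm_weight l k : R :=
  2^-1 * step_const l * (\prod_(k <= j < l.+1) a j) ^+ 2.

Let VD u v : V u -> V v -> V (u + v).
Proof. by move=> Vu Vv; rewrite -[u]scale1r; exact: V_lin. Qed.

Let VZ c u : V u -> V (c *: u).
Proof. by move=> Vu; rewrite -[_ *: _]addr0; exact: V_lin. Qed.

Let VB u v : V u -> V v -> V (u - v).
Proof. by move=> Vu Vv; rewrite -scaleN1r; apply: VD => //; exact: VZ. Qed.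

Let al_gt0 ts : 0 < al ts.
Proof. by apply: prodr_gt0 => t _; exact: alpha_gt0. Qed.

Let a_gt0 j : 0 < a j. Proof. exact: alpha_gt0. Qed.

Let proda_gt0 m l : 0 < \prod_(m <= j < l) a j.
Proof. by apply: prodr_gt0 => j _. Qed.

Let al_rcons ts t : al (rcons ts t) = alpha t * al ts.
Proof. by rewrite -cats1 big_cat big_seq1 mulrC. Qed.

Lemma step_const_gt0 l : (1 <= l <= n)%N -> 0 < step_const l.
Proof.
move=> /LM_ge0[L0 M0 LM0]; apply: lt_le_trans LM0 _; rewrite lerD2l.
rewrite ler_pdivlMr // ler_piMr //.
by apply: prodr_ile1 => j _; rewrite ltW ?a_gt0 // alpha_le1.
Qed.

Lemma Hcoef_step k ts : size ts = k -> Hcoef L M T k ts = al ts * step_const k.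
Proof.
move=> <-; rewrite /Hcoef /Lcoef /Mcoef big_split /= prodfV.
have -> : \prod_(1 <= l < (size ts).+1) alpha (nth 0%N ts l.-1) = al ts.
  by rewrite big_add1 /= [RHS](big_nth 0%N).
rewrite /step_const; lra.
Qed.

Lemma warm_weight_ltn l k : (k <= l)%N ->
  warm_weight l k = a k ^+ 2 * warm_weight l k.+1.
Proof. by move=> kl; rewrite /warm_weight big_ltn ?ltnS // exprMn; lra. Qed.

Lemma warm_weight_diag k : warm_weight k k.+1 = 2^-1 * step_const k.
Proof. by rewrite /warm_weight big_geq // expr1n mulr1. Qed.

Lemma warm_weight_ge0 l k : (1 <= l <= n)%N -> 0 <= warm_weight l k.
Proof.
by move=> ln; rewrite !mulr_ge0 ?sqr_ge0 ?invr_ge0 ?ltW ?step_const_gt0.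
Qed.

Definition potential k ts (w : nat -> 'cV[R]_d) z : R :=
  \sum_(k <= l < n.+1) al ts * warm_weight l k * sqn P (w l - z).

(** Operators of levels below k are absent, their values being already in the linear terms of the
    surrogates. The last term records the strong convexity of those surrogates; it provides the term
    H/2 |z1 - z|_P^2 consumed by the extragradient step of the enclosing level. *)
Definition gap (k : nat) (s : R) (q : nat -> 'cV[R]_d -> R) u z : R :=
  \sum_(1 <= i < n.+1) q i u - \sum_(1 <= i < n.+1) q i z +
  \sum_(k <= i < n.+1) dot (Q i z) (u - z) + s / 2 * sqn P (u - z).

(* The functions of the levels already linearised add up to a quadratic whose
   minimiser lies in the affine space [zin + V]. *)
Definition level_inv ts (q : nat -> 'cV[R]_d -> R) (s : R) : Prop :=
  let k := (size ts).+1 in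
  (forall i, (k <= i <= n)%N ->
     convex_smooth P (al ts * L i) (q i) /\ forall z, V (grad (q i) z)) /\
  ((0 < size ts)%N -> 0 < s) /\ 0 <= s /\
  exists b c, V (b - s *: (P *m zin)) /\
    forall z, \sum_(1 <= i < k) q i z = s / 2 * sqn P z - dot b z + c.

(** The minimiser is (s P)^-1 b, and its displacement from [zin] is (s P)^-1 applied to b - s P zin,
    whence the form of the hypothesis on b. [argmin] picks some minimiser; positive definiteness
    makes it this one. *)
Lemma argmin_quadratic (F : 'cV[R]_d -> R) s b c : 0 < s ->
  V (b - s *: (P *m zin)) ->
  (forall z, F z = s / 2 * sqn P z - dot b z + c) ->
  V (argmin setT F - zin) /\
  forall z, F (argmin setT F) - F z + s / 2 * sqn P (argmin setT F - z) <= 0.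
Proof.
move=> s0 Vb FE; have Pu := posdef_unitmx Ppos.
pose m := s^-1 *: (invmx P *m b).
have FmE z : F z = F m + s / 2 * sqn P (z - m).
  have bE u : dot b u = s * dot (P *m m) u.
    rewrite -dotZl /m -scalemxAr mulKVmx // scalerA mulfV ?gt_eqF //.
    by rewrite scale1r.
  have [u uE] : exists u, u = z - m by eexists.
  have -> : z = m + u by rewrite uE addrC subrK.
  have -> : m + u - m = u by rewrite addrAC subrr add0r.
  by rewrite !FE !bE sqnD // dotDr; lra.
have [_ zmin] : is_argmin setT F (argmin setT F).
  apply: (@getPex _ (is_argmin setT F)); exists m; split=> // z _.
  by rewrite [leRHS]FmE lerDl mulr_ge0 ?sqn_ge0 ?divr_ge0 ?(ltW s0).
have -> : argmin setT F = m.
  have := zmin m I; rewrite FmE gerDl => h.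
  have : sqn P (argmin setT F - m) <= 0.
    by move: h; rewrite pmulr_rle0 // divr_gt0.
  move=> h0; apply/eqP; rewrite -subr_eq0; apply: contraTT h0 => n0.
  by rewrite -ltNge; exact: Ppos.2.
split=> [|z]; last by rewrite (FmE z) sqnBC; lra.
have -> : m - zin = s^-1 *: (invmx P *m (b - s *: (P *m zin))).
  rewrite mulmxBr scalerBr -scalemxAr mulKmx // scalerA mulVf ?gt_eqF //.
  by rewrite scale1r.
by apply/VZ/V_Pinv.
Qed.

Let nat_split k (F : nat -> R) : (k <= n)%N -> (0 < k)%N ->
  \sum_(1 <= i < n.+1) F i =
  \sum_(1 <= i < k) F i + (F k + \sum_(k.+1 <= i < n.+1) F i).
Proof.
move=> kn k0; rewrite (@big_cat_nat _ _ _ k) ?(leqW kn) //=.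
by rewrite [X in _ + X]big_ltn ?ltnS.
Qed.

Lemma convex_sum k ts q a' x y : (1 <= k)%N ->
  (forall i, (k <= i <= n)%N -> convex_smooth P (al ts * L i) (q i)) ->
  0 <= a' <= 1 ->
  \sum_(k <= i < n.+1) q i (a' *: x + (1 - a') *: y) <=
  a' * \sum_(k <= i < n.+1) q i x + (1 - a') * \sum_(k <= i < n.+1) q i y.
Proof.
move=> k1 qcs a01; rewrite !mulr_sumr -big_split /=.
apply: ler_sum_nat => i ki; apply: convex_smooth_convex a01; apply: qcs.
by rewrite -ltnS.
Qed.

Let p_hatE k t (zbar : 'cV[R]_d) q i : (k <= i)%N -> p_hat k t zbar q i =
  (fun z => (alpha t)^-1 * q i (alpha t *: z + (1 - alpha t) *: zbar)).
Proof. by move=> ki; apply/funext => z; rewrite /p_hat ki. Qed.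

Let p_next_gt k ts zbar zk q i : (k < i)%N ->
  p_next P Q L M T k ts zbar zk q i = p_hat k (last 0%N ts) zbar q i.
Proof.
by move=> ki; apply/funext => z; rewrite /p_next gtn_eqF // p_hatE // ltnW.
Qed.

Let p_hat_inv ts t zbar q s i : level_inv ts q s -> (size ts < i <= n)%N ->
  convex_smooth P (al (rcons ts t) * L i) (p_hat (size ts).+1 t zbar q i) /\
  forall z, V (grad (p_hat (size ts).+1 t zbar q i) z).
Proof.
move=> [qcs _] ki; have [csi Vi] := qcs i ki; have /andP[ki' _] := ki.
rewrite p_hatE // al_rcons -mulrA; split.
  exact: rescale_convex_smooth Ppos (alpha_gt0 _) csi.
by move=> z; rewrite (rescale_grad _ _ Ppos (alpha_gt0 _) csi).
Qed.

Let p_next_lt_sum k ts zbar zk q z :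
  \sum_(1 <= i < k) p_next P Q L M T k ts zbar zk q i z = \sum_(1 <= i < k) q i z.
Proof.
apply: eq_big_nat => i /andP[_ ik]; rewrite /p_next ltn_eqF // /p_hat.
by rewrite leqNgt ik.
Qed.

Lemma level_inv_next ts t zbar zk q s : let k := (size ts).+1 in
  let H := Hcoef L M T k (rcons ts t) in
  (k <= n)%N -> V (zk - zin) -> level_inv ts q s ->
  level_inv (rcons ts t) (p_next P Q L M T k (rcons ts t) zbar zk q) (s + H).
Proof.
move=> k H kn Vzk inv; have [qcs [s0 [s_ge0 [b [c [Vb bE]]]]]] := inv.
have H0 : 0 < H by rewrite /H Hcoef_step ?size_rcons // mulr_gt0 ?step_const_gt0.
split; [|split; [|split]].
- move=> i; rewrite size_rcons => /andP[ki iln]; rewrite p_next_gt // last_rcons.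
  by apply: p_hat_inv inv _; rewrite (ltnW ki).
- by rewrite ltr_pwDr.
- by rewrite addr_ge0 // ltW.
have [D DE] : exists D, D = Delta Q k t zbar zk q k by eexists.
have VD_ : V D.
  rewrite DE; apply: VD; last by apply: V_Q; rewrite kn.
  by apply: (p_hat_inv t zbar inv _).2; rewrite ltnSn.
(* Expanding the surrogate of level k around the origin adds H P zk - D to the linear coefficient; D
   lies in V, since gradients and operators take their values there. *)
exists (b + H *: (P *m zk) - D), (c + H / 2 * sqn P zk); split.
  have -> : b + H *: (P *m zk) - D - (s + H) *: (P *m zin) =
      (b - s *: (P *m zin)) + (H *: (P *m (zk - zin)) - D).
    rewrite mulmxBr; move: (P *m zk) (P *m zin) D {VD_ DE} => X Y D.
    by apply/colP => i; rewrite !mxE; ring.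
  by apply: VD => //; apply: VB => //; apply/VZ/V_P.
move=> z; rewrite size_rcons big_nat_recr //= p_next_lt_sum bE /p_next eqxx.
rewrite last_rcons -DE -/H normP2 // -[dot (P *m _) _]/(sqn P _) sqnD // sqnN.
rewrite !dotE (posdef_dotC zk z Ppos) (dotC D); lra.
Qed.

(** Level k is handled by [extragradient_step] applied to its [p_hat]. The levels above k enter the
    inner gap through [p_hat], whose value at z is bounded by convexity between z and [zbar];
    undoing the rescaling gives the factors alpha t and 1 - alpha t. *)
Lemma gap_step ts t q s zbar zk zh zp z D : let k := (size ts).+1 in
  let H := Hcoef L M T k (rcons ts t) in
  (k <= n)%N -> (t < T k)%N -> level_inv ts q s ->
  (forall l, (l < size ts)%N -> (nth 0%N ts l < T l.+1)%N) ->
  zp = zh + invmx (H *: P) *m (Q k zk - Q k zh) ->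
  gap k.+1 (s + H) (p_next P Q L M T k (rcons ts t) zbar zk q) zh z <= D ->
  gap k s q (alpha t *: zh + (1 - alpha t) *: zbar) z <=
  (1 - alpha t) * gap k s q zbar z +
  alpha t * (D + H / 2 * (sqn P (zk - z) - sqn P (zp - z))).
Proof.
move=> k H kn tT inv tsT zpE.
have [qcs [s0 [s_ge0 [b [c [Vb bE]]]]]] := inv.
have k1n : (1 <= k <= n)%N by rewrite kn.
have kkn : (k <= k <= n)%N by rewrite leqnn.
have [L0 M0 LM0] := LM_ge0 k1n.
have H0 : 0 < H by rewrite /H Hcoef_step ?size_rcons // mulr_gt0 ?step_const_gt0.
have a01 : 0 <= alpha t <= 1 by rewrite ltW ?alpha_gt0 // alpha_le1.
have a0 := @alpha_gt0 R t; have a1 := @alpha_le1 R t.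
set zb := _ *: zh + _.
rewrite /gap !(nat_split _ kn) // !p_next_lt_sum !bE.
have pn u : \sum_(k.+1 <= i < n.+1)
      p_next P Q L M T k (rcons ts t) zbar zk q i u =
    (alpha t)^-1 * \sum_(k.+1 <= i < n.+1) q i (alpha t *: u + (1 - alpha t) *: zbar).
  rewrite mulr_sumr; apply: eq_big_nat => i /andP[ki _].
  by rewrite p_next_gt // last_rcons p_hatE // ltnW.
rewrite !pn.
set Fz := \sum_(k.+1 <= i < n.+1) q i z.
set Fb := \sum_(k.+1 <= i < n.+1) q i zbar.
set Fzb := \sum_(k.+1 <= i < n.+1) q i zb.
have hF : \sum_(k.+1 <= i < n.+1) q i (alpha t *: z + (1 - alpha t) *: zbar)
    <= alpha t * Fz + (1 - alpha t) * Fb.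
  apply: (@convex_sum _ ts) a01 => // i /andP[ki iln].
  by apply: (qcs i _).1; rewrite (ltnW ki).
(* Each counter is at most T_l - 1 and alpha is nonincreasing, so every factor of [Mcoef] is at
   least 1 and it dominates the Lipschitz constant. *)
have MH : 0 <= M k <= Mcoef M T k (rcons ts t).
  rewrite M0 /= /Mcoef ler_peMr //.
  apply: (@le_trans _ _ (\prod_(1 <= l < (size (rcons ts t)).+1) 1)).
    by rewrite big1.
  rewrite big_nat [leRHS]big_nat; apply: ler_prod => l /andP[l1 ls]; rewrite ler01 /= ler_pdivlMr //.
  rewrite mul1r; apply: alpha_nonincreasing.
  move: ls; rewrite size_rcons nth_rcons ltnS -/k => lk.
  case: l l1 lk => // l _ lk /=.
  have [ll|] := ltnP l (size ts); first by rewrite -ltnS prednK; [exact: tsT|exact: leq_ltn_trans (tsT _ ll)].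
  move=> sl; have -> : l = size ts by apply/eqP; rewrite eqn_leq sl -ltnS lk.
  by rewrite eqxx -ltnS prednK //; exact: leq_ltn_trans tT.
have LH : 0 <= Lcoef L k (rcons ts t).
  by rewrite mulr_ge0 // prodr_ge0 // => l _; rewrite ltW ?alpha_gt0.
have Lal : al (rcons ts t) * L k = Lcoef L k (rcons ts t).
  rewrite /Lcoef mulrC; congr (_ * _).
  by rewrite big_add1 /= [LHS](big_nth 0%N).
have [pcs _] := p_hat_inv t zbar inv kkn.
rewrite Lal in pcs.
have := extragradient_step z Ppos H0 LH MH erefl pcs (Q_mon k1n) (Q_lip k1n) zpE.
rewrite !p_hatE //.
have hk : q k (alpha t *: z + (1 - alpha t) *: zbar)
    <= alpha t * q k z + (1 - alpha t) * q k zbar.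
  by apply: convex_smooth_convex a01; exact: (qcs k kkn).1.
rewrite -/zb /p_next eqxx last_rcons !normP2 // -![dot (P *m _) _]/(sqn P _).
rewrite /Delta p_hatE //.
set G := grad _ zk + Q k zk; rewrite (dotDl zh) dotNl -/H.
set SQ := \sum_(k.+1 <= i < n.+1) dot (Q i z) (zh - z).
have zbz : zb - z = alpha t *: (zh - z) + (1 - alpha t) *: (zbar - z).
  by rewrite /zb; apply/colP => i; rewrite !mxE; ring.
have -> : \sum_(k <= i < n.+1) dot (Q i z) (zb - z) =
    alpha t * (dot (Q k z) (zh - z) + SQ) +
    (1 - alpha t) * \sum_(k <= i < n.+1) dot (Q i z) (zbar - z).
  rewrite -(@big_ltn _ _ _ _ _ (fun i => dot (Q i z) (zh - z))) ?ltnS //.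
  rewrite !mulr_sumr -big_split /=; apply: eq_bigr => i _.
  by rewrite zbz [LHS]dotDr !dotZr.
have -> : dot b zb = alpha t * dot b zh + (1 - alpha t) * dot b zbar.
  by rewrite /zb dotDr !dotZr.
(* Convexity of the squared norm is used twice: for the sum of the surrogates, which is quadratic,
   and for the strong convexity term of the gap. *)
have N1 : 0 <= s / 2 * (alpha t * sqn P zh + (1 - alpha t) * sqn P zbar - sqn P zb).
  by rewrite mulr_ge0 ?divr_ge0 // subr_ge0 sqn_convex.
have N2 : 0 <= s / 2 * (alpha t * sqn P (zh - z) + (1 - alpha t) * sqn P (zbar - z)
    - sqn P (zb - z)).
  by rewrite mulr_ge0 ?divr_ge0 // subr_ge0 zbz sqn_convex.
have aK x : alpha t * ((alpha t)^-1 * x) = x by rewrite mulVKf // gt_eqF.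
move: hF hk.
set Fzz := \sum_(k.+1 <= i < n.+1) q i (alpha t *: z + _).
set qzz := q k (alpha t *: z + _).
have := aK (q k zb); have := aK qzz; have := aK Fzb; have := aK Fzz.
set iFzz := (alpha t)^-1 * Fzz; set iFzb := (alpha t)^-1 * Fzb.
set iqzz := (alpha t)^-1 * qzz; set iqzb := (alpha t)^-1 * q k zb.
move=> a1E a2E a3E a4E hF hk e1 e2.
have : alpha t * (iqzb - iqzz + dot (Q k z) (zh - z) +
    H / 2 * (sqn P (zp - z) - sqn P (zk - z)) + (s / 2 * sqn P zh - dot b zh)
    + iFzb - (s / 2 * sqn P z - dot b z) - iFzz + SQ + s / 2 * sqn P (zh - z))
    <= alpha t * D.
  by rewrite ler_wpM2l ?(ltW a0) //; lra.
clearbody iFzz iFzb iqzz iqzb SQ G Fz Fb Fzb Fzz qzz zb.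
lra.
Qed.

Lemma Rec_gap r ts q w s :
  (r + size ts)%N = n -> level_inv ts q s ->
  (forall l, (l < size ts)%N -> (nth 0%N ts l < T l.+1)%N) ->
  (forall l, V (w l - zin)) ->
  let k := (size ts).+1 in
  let out := Rec n P setT Q L M T r ts q w in
  [/\ V (out.1 - zin), forall l, V (out.2 l - zin),
      forall l, (l < k)%N -> out.2 l = w l &
      forall z, gap k s q out.1 z <= \sum_(k <= l < n.+1)
        al ts * warm_weight l k * (sqn P (w l - z) - sqn P (out.2 l - z))].
Proof.
elim: r ts q w s => [|r IH] ts q w s rn inv tsT Vw k.
  have [_ [s0 [s_ge0 [b [c [Vb bE]]]]]] := inv.
  move: rn; rewrite add0n => tsn.
  have s1 : 0 < s by apply: s0; rewrite tsn.
  have [Vz zle] := argmin_quadratic s1 Vb bE.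
  rewrite /= -tsn -/k; split=> // z; rewrite [leRHS]big_geq // /gap -tsn -/k.
  by rewrite [X in _ + X + _]big_geq // addr0.
have kn : (k <= n)%N by rewrite -rn addSn ltnS leq_addl.
have k1n : (1 <= k <= n)%N by rewrite kn.
pose body := fun t (st : 'cV[R]_d * (nat -> 'cV[R]_d)) =>
  let ts' := rcons ts t in
  let out := Rec n P setT Q L M T r ts' (p_next P Q L M T k ts' st.1 (st.2 k) q) st.2 in
  (alpha t *: out.1 + (1 - alpha t) *: st.1,
   set_reg out.2 k
     (out.1 + invmx (Hcoef L M T k ts' *: P) *m (Q k (st.2 k) - Q k out.1))).
(* The weights are those of level k + 1, constant during the loop; the missing factor [a k ^+ 2] is
   gained on leaving it. *)
pose pot (v : nat -> 'cV[R]_d) z :=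
  \sum_(k <= l < n.+1) al ts * warm_weight l k.+1 * sqn P (v l - z).
have loop t : (t <= T k)%N -> let st := iteri t body (w k, w) in
  [/\ V (st.1 - zin), forall l, V (st.2 l - zin),
      forall l, (l < k)%N -> st.2 l = w l &
      forall z, (1 - alpha t) / alpha t ^+ 2 * gap k s q st.1 z + pot st.2 z
        <= pot w z].
  elim: t => [|t IHt] tT.
    (* Since alpha 0 = 1, the gap of the initial average has coefficient 0. *)
    by rewrite /=; split=> // z; rewrite subrr mul0r mul0r add0r.
  have := IHt (ltnW tT); set st := iteri t body _ => -[V1 V2 stw stle].
  rewrite -[iteri t.+1 body _]/(body t st) /body; lazy zeta.
  rewrite -[(_, _).1]/(_ + _) -[(_, _).2]/(set_reg _ _ _).
  set zk := st.2 k; set ts' := rcons ts t; set H := Hcoef L M T k ts'.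
  set q' := p_next P Q L M T k ts' st.1 zk q.
  have inv' : level_inv ts' q' (s + H) by exact: (level_inv_next _ _ kn (V2 k) inv).
  have rn' : (r + size ts')%N = n by rewrite size_rcons addnS -addSn.
  have tsT' l : (l < size ts')%N -> (nth 0%N ts' l < T l.+1)%N.
    rewrite size_rcons nth_rcons ltnS leq_eqVlt => /orP[/eqP ->|lts].
      by rewrite ltnn eqxx.
    by rewrite lts tsT.
  have := IH ts' q' st.2 (s + H) rn' inv' tsT' V2; lazy zeta.
  set out := Rec _ _ _ _ _ _ _ _ _ _ _; move=> [VO1 VO2 outw outle].
  set zp := out.1 + _.
  have Vp : V (zp - zin).
    rewrite /zp addrAC; apply: VD => //.
    have H0 : 0 < H by rewrite /H Hcoef_step ?size_rcons // mulr_gt0 ?step_const_gt0.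
    have Pu := posdef_unitmx Ppos.
    rewrite invmxZ ?unitmxZ ?unitfE ?gt_eqF // -scalemxAl.
    by apply/VZ/V_Pinv/VB; apply: V_Q.
  split=> [||l lk|z].
  - have -> : alpha t *: out.1 + (1 - alpha t) *: st.1 - zin =
        alpha t *: (out.1 - zin) + (1 - alpha t) *: (st.1 - zin).
      by apply/colP => i; rewrite !mxE; ring.
    by apply: V_lin => //; exact: VZ.
  - by move=> l; rewrite /set_reg; case: eqP.
  - rewrite /set_reg ltn_eqF // -stw // outw // size_rcons.
    exact: ltnW.
  move/(_ z): outle; rewrite size_rcons => outle.
  have stepz := gap_step kn tT inv tsT (erefl zp) outle.
  rewrite -/k -/H -/zp in stepz.
  (* One factor alpha t passes from [al ts] to [al ts'], which matches the drop granted by the inner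
     call and, as H = [al ts'] times [step_const k], the one granted by the extragradient step. *)
  have potE : alpha t ^+ 2 * (pot (set_reg out.2 k zp) z - pot st.2 z) =
      - (alpha t * (\sum_(k.+1 <= l < n.+1) al ts' * warm_weight l k.+1 *
          (sqn P (st.2 l - z) - sqn P (out.2 l - z)) +
        H / 2 * (sqn P (zk - z) - sqn P (zp - z)))).
    rewrite /pot !(@big_ltn _ _ _ k) ?ltnS // /set_reg eqxx warm_weight_diag.
    rewrite (@eq_big_nat _ _ _ k.+1 n.+1
      (fun l => _ * sqn P ((if l == k then zp else out.2 l) - z))
      (fun l => al ts * warm_weight l k.+1 * sqn P (out.2 l - z))); last first.
      by move=> l /andP[kl _]; rewrite gtn_eqF.
    have -> : \sum_(k.+1 <= l < n.+1) al ts' * warm_weight l k.+1 *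
          (sqn P (st.2 l - z) - sqn P (out.2 l - z)) =
       alpha t * (\sum_(k.+1 <= l < n.+1) al ts * warm_weight l k.+1 * sqn P (st.2 l - z)
        - \sum_(k.+1 <= l < n.+1) al ts * warm_weight l k.+1 * sqn P (out.2 l - z)).
      rewrite -sumrB mulr_sumr; apply: eq_bigr => l _.
      by rewrite al_rcons; ring.
    by rewrite /H Hcoef_step ?size_rcons // al_rcons -/zk; field.
  have a0 := @alpha_gt0 R t; have aa0 : 0 < alpha t ^+ 2 by rewrite exprn_gt0 ?alpha_gt0.
  rewrite alpha_recurrence; apply: le_trans (stle z).
  set g1 := gap _ _ _ _ z in stepz *; set g0 := gap _ _ _ _ z in stepz *.
  rewrite -subr_ge0 -(pmulr_rge0 _ aa0).
  have -> : alpha t ^+ 2 * ((1 - alpha t) / alpha t ^+ 2 * g0 + pot st.2 z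
      - ((alpha t ^+ 2)^-1 * g1 + pot (set_reg out.2 k zp) z)) =
    (1 - alpha t) * g0 - g1 - alpha t ^+ 2 * (pot (set_reg out.2 k zp) z - pot st.2 z).
    by field; rewrite gt_eqF.
  by rewrite potE; lra.
have [V1 V2 outw outle] := loop (T k) (leqnn _).
rewrite -[Rec _ _ _ _ _ _ _ _ _ _ _]/(iteri (T k) body (w k, w)).
split=> // z; have := outle z.
have Tk0 := T_gt0 k1n.
(* At loop exit the coefficient (1 - alpha T) / alpha T ^ 2 equals the inverse of alpha (T - 1) ^ 2,
   that is, of [a k ^+ 2]. *)
rewrite -{1 2}(prednK Tk0) alpha_recurrence.
set out := iteri _ _ _; set g := gap _ _ _ _ _ => gle.
have -> : \sum_(k <= l < n.+1) al ts * warm_weight l k *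
    (sqn P (w l - z) - sqn P (out.2 l - z)) = a k ^+ 2 * (pot w z - pot out.2 z).
  rewrite /pot -sumrB mulr_sumr; apply: eq_big_nat => l /andP[kl _].
  by rewrite warm_weight_ltn //; ring.
have aa0 : 0 < a k ^+ 2 by rewrite exprn_gt0 ?a_gt0.
by rewrite -ler_pdivrMl //; lra.
Qed.

Lemma algorithm1_gap p :
  (forall i, (1 <= i <= n)%N ->
     convex_smooth P (L i) (p i) /\ forall z, V (grad (p i) z)) ->
  let zout := algorithm1 n P setT p Q L M T zin in
  V (zout - zin) /\ forall z,
  \sum_(1 <= i < n.+1) p i zout - \sum_(1 <= i < n.+1) p i z +
  \sum_(1 <= i < n.+1) dot (Q i z) (zout - z) <=
  \sum_(1 <= l < n.+1) warm_weight l 1 * sqn P (zin - z).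
Proof.
move=> pcs zout.
have inv : level_inv [::] p 0.
  split; first by move=> i; rewrite big_nil mul1r; exact: pcs.
  split=> //; split=> //; exists 0, 0; rewrite scale0r subr0; split=> // z.
  by rewrite big_geq // dot0l mul0r mul0r subrr addr0.
have tsT l : (l < size (@nil nat))%N -> (nth 0%N [::] l < T l.+1)%N by [].
have Vw (l : nat) : V (zin - zin) by rewrite subrr.
have [V1 _ _ gle] := Rec_gap (ts := [::]) (w := fun=> zin) (addn0 n) inv tsT Vw.
split=> // z; have := gle z; rewrite /gap mul0r mul0r addr0 big_nil.
move=> /le_trans; apply; apply: ler_sum_nat => l ln.
rewrite mul1r mulrBr gerBl mulr_ge0 ?sqn_ge0 // warm_weight_ge0 //.
Qed.

End Sliding.

(** * Orthogonal complements, and zeros of strongly monotone operators *)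

Definition orthogonal_to {R : realType} {d} (K : set 'cV[R]_d) : set 'cV[R]_d :=
  [set x | forall k, K k -> dot x k = 0].

Section OrthogonalComplement.
Context {R : realType} {d : nat} (K : set 'cV[R]_d).

Lemma orthogonal_to0 : orthogonal_to K 0.
Proof. by move=> k _; rewrite dot0l. Qed.

Lemma orthogonal_to_lin a u v :
  orthogonal_to K u -> orthogonal_to K v -> orthogonal_to K (a *: u + v).
Proof. by move=> Ku Kv k Kk; rewrite !dotE Ku // Kv // mulr0 addr0. Qed.

Lemma orthogonal_to_closed : closed (orthogonal_to K).
Proof.
rewrite (_ : orthogonal_to K =
  \bigcap_(k in K) ((fun x => dot x k) @^-1` [set 0])); last first.
  by apply/seteqP; split=> x.
apply: closed_bigI => k _; apply: preimage_closed; last exact: closed_eq.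
by move=> x _; exact: dot_continuousl.
Qed.

End OrthogonalComplement.

Section StronglyMonotoneZero.
Context {R : realType} {d : nat} (G : 'cV[R]_d -> 'cV[R]_d) (V : set 'cV[R]_d).
Context (z0 : 'cV[R]_d) (c K : R) (c0 : 0 < c) (K0 : 0 < K).
Context (V_closed : closed V) (V0 : V 0).
Context (V_lin : forall a u v, V u -> V v -> V (a *: u + v)).
Context (V_G : forall z, V (G z)).
Context (G_mono : forall z z', V (z - z') ->
  c * dot (z - z') (z - z') <= dot (G z - G z') (z - z')).
Context (G_lip : forall z z',
  dot (G z - G z') (G z - G z') <= K * dot (z - z') (z - z')).

Let enorm_G z z' : enorm (G z - G z') <= Num.sqrt K * enorm (z - z').
Proof. by rewrite -sqrtrM ?(ltW K0) // ler_sqrt ?G_lip // mulr_ge0 ?dot_ge0 ?ltW. Qed.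

(* A zero is a minimiser of [|G|] on [z0 + V], because one step of
   [z |-> z - (c / K) G z] strictly decreases [|G|] otherwise. *)
Lemma strongly_monotone_zero : exists2 z, V (z - z0) & G z = 0.
Proof.
(* Strong monotonicity gives c |z - z0| <= |G z| + |G z0|, so beyond this radius |G z| exceeds |G
   z0|: the minimum over the compact set A is one over the whole of z0 + V. *)
pose r := 2 * enorm (G z0) / c.
pose A := [set z | V (z - z0)] `&` [set z | enorm (z - z0) <= r].
have r0 : 0 <= r by rewrite divr_ge0 ?mulr_ge0 ?enorm_ge0 ?(ltW c0).
have Az0 : A z0 by split; rewrite /= subrr // /enorm dot0l sqrtr0.
have cA : closed A.
  apply: closedI.
    have cs : continuous (fun z : 'cV[R]_d => z - z0).
      by move=> z; apply: continuousB => [?|]; last exact: cst_continuous.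
    by apply: (preimage_closed _ V_closed) => z _; exact: cs.
  have ce : continuous (fun z : 'cV[R]_d => enorm (z - z0)).
    apply: (@lipschitz_continuous_cV _ _ _ 1) => x y.
    rewrite mul1r; apply: le_trans (enorm_dist _ _) _.
    by rewrite opprB addrA subrK.
  by have := preimage_closed (fun z _ => ce z) (@closed_le R r).
have cG : continuous (fun z => enorm (G z)).
  apply: (@lipschitz_continuous_cV _ _ _ (Num.sqrt K)) => x y.
  exact: le_trans (enorm_dist _ _) (enorm_G x y).
have bA z : A z -> enorm z <= r + enorm z0.
  by move=> [_ /= zr]; rewrite -{1}(subrK z0 z) (le_trans (enormD _ _)) // lerD2r.
have [zm [Vzm _] zmin] := cV_EVT_min cG cA (ex_intro _ _ Az0) bA.
have gmin z : V (z - z0) -> enorm (G zm) <= enorm (G z).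
  move=> Vz; have [zr|rz] := leP (enorm (z - z0)) r; first exact: zmin.
  apply: le_trans (zmin _ Az0) _.
  have e0 : 0 < enorm (z - z0) := le_lt_trans r0 rz.
  have : c * enorm (z - z0) <= enorm (G z) + enorm (G z0).
    rewrite -(ler_pM2r e0) -mulrA -expr2 enorm2.
    apply: le_trans (G_mono Vz) _.
    apply: le_trans (dot_le_enorm _ _) _.
    by rewrite ler_pM2r // (le_trans (enormD _ _)) // enormN.
  move: rz; rewrite /r ltr_pdivrMr //; lra.
exists zm => //; apply: dot_le0.
have [g gE] : exists g, g = G zm by eexists.
pose z1 := zm - (c / K) *: g.
have z1zm : z1 - zm = - ((c / K) *: g) by rewrite /z1 addrAC subrr add0r.
have Vz1m : V (z1 - zm).
  by rewrite z1zm -scaleNr -[_ *: _]addr0; apply: V_lin; rewrite ?gE.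
have := G_mono Vz1m; have := G_lip z1 zm; rewrite z1zm -gE.
have : dot g g <= dot (G z1) (G z1).
  have := gmin z1; rewrite enorm_le -gE; apply.
  rewrite -(subrK zm z1) -addrA -[X in V (X + _)]scale1r; exact: V_lin.
rewrite !dotE (dotC g (G z1)).
set gg := dot g g; set a := dot (G z1) g; set b := dot (G z1) _.
have ck0 : 0 < c / K by rewrite divr_gt0.
have hK : K * (c / K) = c by rewrite mulrC divfK // gt_eqF.
set e := c / K in ck0 hK *; move=> h1 h2 h3.
(* With g = G zm and e = c / K, monotonicity gives <G z1, g> <= (1 - c e) |g|^2 and the Lipschitz
   bound gives |G z1 - g|^2 <= c e |g|^2. Together with |g| <= |G z1| they force c e |g|^2 <= 0. *)
have h4 : c * (e * gg) <= gg - a.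
  rewrite -(ler_pM2l ck0); lra.
have h5 : b - a - a + gg <= c * (e * gg) by rewrite -hK; lra.
have : 0 < c * e by rewrite mulr_gt0.
have : c * e * gg <= 0 by lra.
by move=> + ce0; rewrite pmulr_rle0.
Qed.

End StronglyMonotoneZero.

(** * Spectral bounds on the coupling matrix along V *)

Section Coupling.
Context {R : realType} {m d : nat} (B : 'M[R]_(m, d)) (h : 'cV[R]_d -> R).

(* The directions in which the solution set can extend: [ker B] when all
   gradients of [h] lie in [range B^T], nothing otherwise. *)
Definition flat_directions : set 'cV[R]_d :=
  [set k | k = 0 \/ (grad_f_in_range B h /\ B *m k = 0)].

Local Notation V := (orthogonal_to flat_directions).

Lemma orthogonal_grad x : V (grad h x).
Proof.
move=> k [->|[hB Bk]]; first by rewrite dot0r.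
by have [w _ <-] := hB x; rewrite dot_mull trmxK Bk dot0r.
Qed.

Lemma orthogonal_range y : V (B^T *m y).
Proof.
by move=> k [->|[_ Bk]]; rewrite ?dot0r // dot_mull trmxK Bk dot0r.
Qed.

Let gram := B^T *m B.

Let gramT : gram^T = gram. Proof. by rewrite trmx_mul trmxK. Qed.

Let dot_gram (x : 'cV[R]_d) : dot (gram *m x) x = dot (B *m x) (B *m x).
Proof. by rewrite -mulmxA dot_mull trmxK. Qed.

Let eigenvalue_gram l (v : 'cV[R]_d) : v != 0 -> gram *m v = l *: v -> eigenvalue gram l.
Proof.
move=> v0 gv; apply/eigenvalueP; exists v^T.
  by rewrite -[in LHS]gramT -trmx_mul gv linearZ.
by apply: contra v0 => /eqP v0; rewrite -[v]trmxK v0 trmx0.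
Qed.

Lemma lambda_max_bound L2 x : (lambda_max gram <= L2%:E)%E ->
  dot (B *m x) (B *m x) <= L2 * dot x x.
Proof.
move=> lmax; have [->|x0] := eqVneq x 0; first by rewrite mulmx0 !dot0r mulr0.
have [|||||l [v [_ v0 gv lmin]]] := @symmetric_min_eigenvalue R d (- gram) setT => //.
- by rewrite linearN /= gramT.
- by exists x.
have : (- l) <= L2.
  rewrite -lee_fin; apply: le_trans lmax; apply: ereal_sup_ubound; exists (- l) => //=.
  apply: (eigenvalue_gram v0); rewrite scaleNr -gv mulNmx opprK //.
move=> lL; have := lmin x I; rewrite mulNmx dotNl dot_gram.
have := dot_ge0 x; nra.
Qed.

(** The smallest eigenvalue of the Gram matrix restricted to V serves both cases. When the gradients
    lie in range B^T it is positive, because an eigenvector in V killed by B would be a flat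
    direction, hence orthogonal to itself; otherwise any eigenvalue is bounded by the hypothesis. *)
Lemma lambda_min_bound mu2 x :
  (grad_f_in_range B h -> (mu2%:E <= lambda_minp gram)%E) ->
  (~ grad_f_in_range B h -> (mu2%:E <= lambda_min gram)%E) ->
  V x -> mu2 * dot x x <= dot (B *m x) (B *m x).
Proof.
move=> lminp lmin0 Vx.
have [->|x0] := eqVneq x 0; first by rewrite mulmx0 !dot0r mulr0.
have [|||||l [v [Vv v0 gv lmin]]] := @symmetric_min_eigenvalue R d gram V => //.
- exact: orthogonal_to_closed.
- exact: orthogonal_to_lin.
- by move=> u _; rewrite -mulmxA; exact: orthogonal_range.
- by exists x.
have vv0 : 0 < dot v v by rewrite lt_def dot_eq0 v0 dot_ge0.
have eig := eigenvalue_gram v0 gv.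
suff mul : mu2 <= l.
  by apply: le_trans (_ : l * dot x x <= _); rewrite ?ler_wpM2r ?dot_ge0 // -dot_gram lmin.
have lE : l * dot v v = dot (B *m v) (B *m v) by rewrite -dot_gram gv dotZl.
have [hB|hB] := pselect (grad_f_in_range B h); rewrite -lee_fin.
  apply: le_trans (lminp hB) _; apply: ereal_inf_lbound; exists l => //=; split=> //.
  rewrite -(pmulr_lgt0 _ vv0) lE lt_def dot_ge0 dot_eq0 andbT.
  apply/eqP => Bv; move: vv0; rewrite Vv ?ltxx //; by right.
by apply: le_trans (lmin0 hB) _; apply: ereal_inf_lbound; exists l.
Qed.

(** The disjunction is what positivity of delta amounts to. If mu > 0, then k = 0; otherwise either
    the kernel of B is flat by definition, or V is the whole space and B is injective. *)
Lemma flat_directionsP mu mu' k :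
  (forall x, V x -> mu' ^+ 2 * dot x x <= dot (B *m x) (B *m x)) ->
  0 <= mu -> 0 < mu \/ mu' != 0 ->
  mu * dot k k <= 0 -> B *m k = 0 -> flat_directions k.
Proof.
move=> VB mu0 [mup|mu'0] muk Bk.
  by left; apply: dot_le0; rewrite -(pmulr_rle0 _ mup).
have [hB|hB] := pselect (grad_f_in_range B h); first by right.
left; have Vk : V k by move=> k' [->|[]//]; rewrite dot0r.
have := VB k Vk; rewrite Bk dot0r pmulr_rle0 ?exprn_even_gt0 //.
exact: dot_le0.
Qed.

End Coupling.

(** * Optimality in the primal and dual problems, and distances to their solution sets *)

Section PrimalOptimality.
Context {R : realType} {dx dy : nat} (B : 'M[R]_(dy, dx)).
Context (f : 'cV[R]_dx -> R) (g : 'cV[R]_dy -> R) (xs : 'cV[R]_dx) (ys : 'cV[R]_dy).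
Context (cf : forall x x', 0 <= bregman f x x') (cg : forall y y', 0 <= bregman g y y').
Context (fxs : grad f xs + B^T *m ys = 0) (gys : grad g ys = B *m xs).

Lemma fenchel_grad y : fenchel g (grad g y) = (dot (grad g y) y - g y)%:E.
Proof.
apply/eqP; rewrite eq_le; apply/andP; split; last first.
  by apply: ereal_sup_ubound; exists y.
apply: ge_ereal_sup => _ [y' _ <-]; rewrite lee_fin.
by have := cg y' y; rewrite /bregman !dotE; lra.
Qed.

Lemma primal_solution : primal_solutions B f g xs.
Proof.
move=> x; rewrite /primal -gys fenchel_grad.
apply: (@le_trans _ _ ((f x)%:E + (dot (B *m x) ys - g ys)%:E)%E); last first.
  by rewrite leeD2l //; apply: ereal_sup_ubound; exists ys.
rewrite -!EFinD lee_fin gys; have := cf x xs; rewrite /bregman.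
have -> : grad f xs = - (B^T *m ys) by apply/eqP; rewrite -addr_eq0 fxs.
rewrite !dotE !(dot_mull B^T) trmxK (dotC ys) (dotC ys); lra.
Qed.

(** Bounding the conjugate at B x from below by the test point ys + t v, v = B (x - xs), and using
    the quadratic upper model of g gives an inequality for every t. At t = 0 it kills the Bregman
    distance; at t = 1 / Lg, where the quadratic in t is largest, it kills v. *)
Lemma primal_solution_flat Lg x : 0 < Lg -> smooth Lg g ->
  primal_solutions B f g x ->
  bregman f x xs <= 0 /\ B *m (x - xs) = 0.
Proof.
move=> Lg0 sg opt.
have [v vE] : exists v, v = B *m (x - xs) by eexists.
have key t : bregman f x xs + t * dot v v - Lg / 2 * t ^+ 2 * dot v v <= 0.
  have [y yE] : exists y, y = ys + t *: v by eexists.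
  have yys : y - ys = t *: v by rewrite yE addrAC subrr add0r.
  have : ((f x + (dot (B *m x) y - g y))%:E <= primal B f g xs)%E.
    apply: le_trans (opt xs); rewrite EFinD leeD2l //.
    by apply: ereal_sup_ubound; exists y.
  rewrite /primal -gys fenchel_grad -EFinD lee_fin gys.
  have := ler_norm (bregman g y ys); have := sg y ys.
  rewrite enorm2 yys dotZl dotZr /bregman yys.
  have -> : grad f xs = - (B^T *m ys) by apply/eqP; rewrite -addr_eq0 fxs.
  rewrite gys yE dotNl (dot_mull B^T) trmxK -vE.
  have -> : B *m x = v + B *m xs by rewrite vE mulmxBr subrK.
  rewrite !dotE (dotC ys v); lra.
have h0 := key 0; rewrite !(mul0r, mulr0, expr0n, subr0, addr0) /= in h0.
split; first by lra.
rewrite -vE; apply: dot_le0.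
have := key Lg^-1; have := cf x xs.
have -> : Lg / 2 * Lg^-1 ^+ 2 * dot v v = Lg^-1 * dot v v / 2.
  by field; rewrite gt_eqF.
move=> h1 h2; have : Lg^-1 * dot v v <= 0 by lra.
by rewrite pmulr_rle0 ?invr_gt0.
Qed.

End PrimalOptimality.

(** Up to sign the dual problem is the primal one with f and g exchanged and - B^T as coupling, so
    every dual fact is an instance of a primal one. *)
Lemma dual_solutionsE {R : realType} {dx dy} (B : 'M[R]_(dy, dx))
    (f : 'cV[R]_dx -> R) (g : 'cV[R]_dy -> R) :
  dual_solutions B f g = primal_solutions (- B^T) g f.
Proof.
have dE y : dual B f g y = (- primal (- B^T) g f y)%E.
  by rewrite /dual /primal mulNmx oppeD ?fin_num_adde_defr.
by apply/seteqP; split=> y opt y'; have := opt y'; rewrite !dE leeN2.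
Qed.

(** Pythagoras: x - xs is orthogonal to every displacement x' - xs inside A. *)
Lemma edist_orthogonal {R : realType} {d} (A K : set 'cV[R]_d) (x xs : 'cV[R]_d) :
  A xs -> (forall x', A x' -> K (x' - xs)) -> orthogonal_to K (x - xs) ->
  (forall x', A x' -> enorm (x - xs) <= enorm (x - x')) /\
  Defs.edist x A = enorm (x - xs).
Proof.
move=> Axs AK xK.
have lb x' : A x' -> enorm (x - xs) <= enorm (x - x').
  move=> Ax'; rewrite enorm_le.
  have -> : x - x' = (x - xs) - (x' - xs) by rewrite opprB addrA subrK.
  have := xK _ (AK _ Ax').
  move: (x - xs) (x' - xs) => u k uk; rewrite !dotE (dotC k u) uk.
  by have := dot_ge0 k; lra.
split=> //; apply/eqP; rewrite eq_le; apply/andP; split.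
  apply: ge_inf; last by exists xs.
  by exists 0 => _ [x' _ <-]; exact: enorm_ge0.
apply: lb_le_inf; first by exists (enorm (x - xs)), xs.
by move=> _ [x' Ax' <-]; exact: lb.
Qed.

(** * Gradient inequalities for a strongly convex smooth function *)

Section GradientBounds.
Context {R : realType} {d : nat} (h : 'cV[R]_d -> R) (mu L : R).
Context (ch : convex h) (sch : strongly_convex mu h) (sh : smooth L h) (L0 : 0 < L).

Lemma bregman_ge0 x y : 0 <= bregman h x y.
Proof. by have := ch x y; rewrite mul0r mul0r. Qed.

Lemma bregman_ge x y : mu / 2 * dot (x - y) (x - y) <= bregman h x y.
Proof. by rewrite -enorm2. Qed.

Lemma bregman_le x y : bregman h x y <= L / 2 * dot (x - y) (x - y).
Proof. by rewrite -enorm2; exact: le_trans (ler_norm _) (sh x y). Qed.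

Lemma grad_bregman x y :
  dot (grad h x - grad h y) (grad h x - grad h y) <= 2 * L * bregman h x y.
Proof.
have sP z : bregman h z x <= L / 2 * normP 1%:M (z - x) ^+ 2.
  by rewrite normP2 ?mul1mx ?bregman_le //; exact: posdef1.
have := cocoercive (@posdef1 R d) L0 (bregman_ge0 ^~ y) sP.
rewrite normP_inv2 ?invmx1 ?mul1mx; last exact: posdef1.
by rewrite ler_pdivrMl ?mulr_gt0.
Qed.

Lemma grad_monotone_mu x y :
  mu * dot (x - y) (x - y) <= dot (grad h x - grad h y) (x - y).
Proof.
rewrite -bregman_sym; have := bregman_ge x y; have := bregman_ge y x.
by rewrite -(opprB x y) dotNl dotNr opprK; lra.
Qed.

Lemma grad_cocoercive x y :
  dot (grad h x - grad h y) (grad h x - grad h y) <=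
  L * dot (grad h x - grad h y) (x - y).
Proof.
rewrite -bregman_sym; have := grad_bregman x y; have := grad_bregman y x.
by rewrite -(opprB (grad h x)) dotNl dotNr opprK; lra.
Qed.

Lemma grad_lipschitz x y :
  dot (grad h x - grad h y) (grad h x - grad h y) <=
  L ^+ 2 * dot (x - y) (x - y).
Proof.
have := grad_bregman x y; have := bregman_le x y.
rewrite -(ler_pM2l (mulr_gt0 (ltr0n R 2) L0)); lra.
Qed.

End GradientBounds.

(** * The solution set of the saddle-point problem: flatness, existence in a coset, projections *)

Section SaddlePoint.
Context {R : realType} {dx dy : nat} (B : 'M[R]_(dy, dx)).
Context (f : 'cV[R]_dx -> R) (g : 'cV[R]_dy -> R) (pi : params R).
Context (cf : convex f) (cg : convex g) (adm : admissible pi).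
Context (reg : regular B f g pi).
Context (delta_gt0 : 0 < Num.min (delta_x pi) (delta_y pi)).

Local Notation Kx := (flat_directions B f).
Local Notation Ky := (flat_directions B^T g).
Local Notation Vx := (orthogonal_to Kx).
Local Notation Vy := (orthogonal_to Ky).

Definition flat_pairs : set 'cV[R]_(dx + dy) :=
  [set k | Kx (usubmx k) /\ Ky (dsubmx k)].

Local Notation V := (orthogonal_to flat_pairs).

Lemma orthogonal_pairsP z : V z <-> Vx (usubmx z) /\ Vy (dsubmx z).
Proof.
split=> [Vz|[Vzx Vzy] k [kx ky]]; last first.
  by rewrite dot_split Vzx // Vzy // addr0.
split=> k kk.
  have /Vz : flat_pairs (col_mx k 0).
    by split; rewrite /= ?col_mxKu ?col_mxKd //; left.
  by rewrite dot_split col_mxKu col_mxKd dot0r addr0.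
have /Vz : flat_pairs (col_mx 0 k).
  by split; rewrite /= ?col_mxKu ?col_mxKd //; left.
by rewrite dot_split col_mxKu col_mxKd dot0r add0r.
Qed.

Let Lx_gt0 : 0 < Lx pi. Proof. by case: adm => /andP[h1 h2] *; exact: le_lt_trans h2. Qed.
Let Ly_gt0 : 0 < Ly pi. Proof. by case: adm => _ /andP[h1 h2] *; exact: le_lt_trans h2. Qed.
Let Lxy_gt0 : 0 < Lxy pi. Proof. by case: adm => _ _ /andP[h1 h2] *; exact: le_lt_trans h2. Qed.
Let mux_ge0 : 0 <= mux pi. Proof. by case: adm => /andP[]. Qed.
Let muy_ge0 : 0 <= muy pi. Proof. by case: adm => _ /andP[]. Qed.
Let dx_gt0 : 0 < delta_x pi. Proof. by move: delta_gt0; rewrite lt_min => /andP[]. Qed.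
Let dy_gt0 : 0 < delta_y pi. Proof. by move: delta_gt0; rewrite lt_min => /andP[]. Qed.

Let sf : smooth (Lx pi) f. Proof. by case: reg => -[]. Qed.
Let sg : smooth (Ly pi) g. Proof. by case: reg => _ []. Qed.
Let scf : strongly_convex (mux pi) f. Proof. by case: reg => -[]. Qed.
Let scg : strongly_convex (muy pi) g. Proof. by case: reg => _ []. Qed.

Lemma coupling_le (x : 'cV[R]_dx) : dot (B *m x) (B *m x) <= Lxy pi ^+ 2 * dot x x.
Proof. by apply: lambda_max_bound; case: reg. Qed.

(** With u = B^T y one has |u|^2 = <y, B u>; Young's inequality with weight Lxy^2 reduces this to
    the bound on B u. *)
Lemma coupling_leT (y : 'cV[R]_dy) : dot (B^T *m y) (B^T *m y) <= Lxy pi ^+ 2 * dot y y.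
Proof.
have [->|u0] := eqVneq (B^T *m y) 0; first by rewrite dot0l mulr_ge0 ?sqr_ge0 ?dot_ge0.
have [u uE] : exists u, u = B^T *m y by eexists.
rewrite -uE in u0 *; have u2 : 0 < dot u u by rewrite lt_def dot_eq0 u0 dot_ge0.
have : 2 * dot u u <= dot y y * Lxy pi ^+ 2 + dot u u.
  have l20 : 0 < Lxy pi ^+ 2 by rewrite exprn_gt0.
  have := dot_young y (B *m u) l20; rewrite dot_mulr -uE => /le_trans; apply.
  rewrite mulrC lerD2l ler_pdivrMl //; exact: coupling_le.
lra.
Qed.

Lemma coupling_ge x : Vx x -> muxy pi ^+ 2 * dot x x <= dot (B *m x) (B *m x).
Proof. by case: reg => _ _ [h1 h2] _ _; exact: lambda_min_bound. Qed.

Lemma coupling_geT y : Vy y -> muyx pi ^+ 2 * dot y y <= dot (B^T *m y) (B^T *m y).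
Proof.
case: reg => _ _ _ [h1 h2] _; apply: lambda_min_bound;
  by rewrite /grad_f_in_range trmxK.
Qed.

Let flatx k : mux pi * dot k k <= 0 -> B *m k = 0 -> Kx k.
Proof.
apply: flat_directionsP coupling_ge mux_ge0 _.
move: dx_gt0; rewrite /delta_x; have [->|] := eqVneq (muxy pi) 0; last by right.
by rewrite expr0n mul0r addr0; left.
Qed.

Let flaty k : muy pi * dot k k <= 0 -> B^T *m k = 0 -> Ky k.
Proof.
apply: flat_directionsP coupling_geT muy_ge0 _.
move: dy_gt0; rewrite /delta_y; have [->|] := eqVneq (muyx pi) 0; last by right.
by rewrite expr0n mul0r addr0; left.
Qed.

(** With x and y the two components of z - z', the optimality conditions make the gradient
    differences - B^T y and B x. Monotonicity of both gradients then gives <B^T y, x> opposite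
    signs, so it vanishes; cocoercivity yields B x = 0 and B^T y = 0, and strong convexity the
    vanishing of mu_x |x|^2 and mu_y |y|^2. *)
Lemma solutions_flat z z' :
  solutions B f g z -> solutions B f g z' -> flat_pairs (z - z').
Proof.
move=> [fz gz] [fz' gz'].
have fxz u : grad f (usubmx u) + B^T *m dsubmx u = 0 ->
    grad f (usubmx u) = - (B^T *m dsubmx u).
  by move=> h; apply/eqP; rewrite -addr_eq0 h.
have fE := fxz _ fz; have fE' := fxz _ fz'.
have gE : grad g (dsubmx z) = B *m usubmx z by apply/eqP; rewrite -subr_eq0 gz.
have gE' : grad g (dsubmx z') = B *m usubmx z' by apply/eqP; rewrite -subr_eq0 gz'.
rewrite /flat_pairs /= !linearB /=.
have := grad_cocoercive cf sf Lx_gt0 (usubmx z) (usubmx z').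
have := grad_cocoercive cg sg Ly_gt0 (dsubmx z) (dsubmx z').
have := grad_monotone_mu scf (usubmx z) (usubmx z').
have := grad_monotone_mu scg (dsubmx z) (dsubmx z').
rewrite fE fE' gE gE' -opprD -!mulmxBr.
move: (usubmx z - usubmx z') (dsubmx z - dsubmx z') => x y.
rewrite !dotNl !dotNr opprK (dot_mull B) (dotC x).
set s := dot (B^T *m y) x => h1 h2 h3 h4.
have x0 := mulr_ge0 mux_ge0 (dot_ge0 x); have y0 := mulr_ge0 muy_ge0 (dot_ge0 y).
have s0 : s = 0 by lra.
rewrite s0 ?oppr0 ?mulr0 in h1 h2 h3 h4.
by split; [apply: flatx => //; apply: dot_le0 | apply: flaty => //; apply: dot_le0].
Qed.

Definition solution_residual (z : 'cV[R]_(dx + dy)) :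
    'cV[R]_dx * 'cV[R]_dy :=
  (grad f (usubmx z) + B^T *m dsubmx z, grad g (dsubmx z) - B *m usubmx z).

(* The saddle operator is monotone but not strongly so; composing it with the
   transpose of [(x, y) |-> (x + B^T y / L_x, y - B x / L_y)] makes it strongly
   monotone along [V]. *)
Definition skewed_residual (z : 'cV[R]_(dx + dy)) : 'cV[R]_(dx + dy) :=
  let F := solution_residual z in
  col_mx (F.1 - (Ly pi)^-1 *: (B^T *m F.2)) (F.2 + (Lx pi)^-1 *: (B *m F.1)).

Lemma orthogonal_rangeT (x : 'cV[R]_dx) : Vy (B *m x).
Proof. by have := @orthogonal_range R _ _ B^T g x; rewrite trmxK. Qed.

Let V_skewed z : V (skewed_residual z).
Proof.
have V1 : Vx (solution_residual z).1.
  rewrite -[X in Vx (X + _)]scale1r; apply: orthogonal_to_lin.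
    exact: orthogonal_grad.
  exact: orthogonal_range.
have V2 : Vy (solution_residual z).2.
  rewrite -[X in Vy (X + _)]scale1r; apply: orthogonal_to_lin.
    exact: orthogonal_grad.
  by rewrite -mulmxN; exact: orthogonal_rangeT.
apply/orthogonal_pairsP; rewrite col_mxKu col_mxKd; split.
  rewrite addrC -scaleNr; apply: orthogonal_to_lin V1; exact: orthogonal_range.
rewrite addrC; apply: orthogonal_to_lin V2; exact: orthogonal_rangeT.
Qed.

(** The skew map is injective: u = B^T v / L_y and v = - B u / L_x force |u|^2 = - |B u|^2 / (L_x
    L_y). *)
Let skewed_residual_zero z : skewed_residual z = 0 -> solutions B f g z.
Proof.
rewrite /skewed_residual -[RHS]col_mx0 => /eq_col_mx[].
rewrite /solution_residual /solutions /=.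
move: (_ + B^T *m _) (_ - B *m _) => u v /eqP; rewrite subr_eq0 => /eqP uE.
move=> /eqP; rewrite addr_eq0 => /eqP vE.
have u0 : u = 0.
  apply: dot_le0; rewrite [X in dot X _]uE dotZl dot_mull trmxK vE dotNl dotZl.
  by rewrite mulrN oppr_le0 !mulr_ge0 ?dot_ge0 ?invr_ge0 ?ltW.
by split=> //; rewrite vE u0 mulmx0 scaler0 oppr0.
Qed.

Let skewedB z z' (x := usubmx (z - z')) (y := dsubmx (z - z'))
    (p := grad f (usubmx z) - grad f (usubmx z'))
    (q := grad g (dsubmx z) - grad g (dsubmx z')) :
  skewed_residual z - skewed_residual z' =
  col_mx (p + B^T *m y - (Ly pi)^-1 *: (B^T *m (q - B *m x)))
         (q - B *m x + (Lx pi)^-1 *: (B *m (p + B^T *m y))).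
Proof.
have xE : x = usubmx z - usubmx z' by rewrite /x linearB.
have yE : y = dsubmx z - dsubmx z' by rewrite /y linearB.
rewrite /skewed_residual opp_col_mx add_col_mx xE yE.
have e1 : p + B^T *m (dsubmx z - dsubmx z') =
    (solution_residual z).1 - (solution_residual z').1.
  by rewrite /= mulmxBr opprD addrACA.
have e2 : q - B *m (usubmx z - usubmx z') =
    (solution_residual z).2 - (solution_residual z').2.
  rewrite /= mulmxBr !opprB addrACA [RHS]addrACA; congr (_ + _); rewrite addrC //.
rewrite e1 e2.
move: (solution_residual z) (solution_residual z') => [a b] [a' b'] /=.
rewrite !mulmxBr !scalerBr; move: (B^T *m b) (B^T *m b') (B *m a) (B *m a') => *.

by congr col_mx; apply/colP => i; rewrite !mxE; ring.
Qed.

(** The bilinear terms cancel, and the skew map adds |B^T y|^2 / L_x and |B x|^2 / L_y. Its cross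
    terms with the gradient differences cost half of these squares and half of the cocoercivity; the
    other halves give mu and the spectral part of delta, hence the factor 1/2. *)
Let skewed_mono z z' : V (z - z') ->
  Num.min (delta_x pi) (delta_y pi) / 2 * dot (z - z') (z - z') <=
  dot (skewed_residual z - skewed_residual z') (z - z').
Proof.
move=> /orthogonal_pairsP[].
have := grad_cocoercive cf sf Lx_gt0 (usubmx z) (usubmx z').
have := grad_cocoercive cg sg Ly_gt0 (dsubmx z) (dsubmx z').
have := grad_monotone_mu scf (usubmx z) (usubmx z').
have := grad_monotone_mu scg (dsubmx z) (dsubmx z').
rewrite skewedB !(dot_split _ (z - z')) !col_mxKu !col_mxKd.
move: (grad f _ - grad f _) (grad g _ - grad g _) => p q.
have -> : usubmx z - usubmx z' = usubmx (z - z') by rewrite linearB.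
have -> : dsubmx z - dsubmx z' = dsubmx (z - z') by rewrite linearB.
move: (usubmx _) (dsubmx _) => x y my mx cy cx Vx' Vy'.
have := coupling_ge Vx'; have := coupling_geT Vy'.
have [u uE] : exists u, u = B^T *m y by eexists.
have [v vE] : exists v, v = B *m x by eexists.
have ux : dot u x = dot v y by rewrite uE vE dot_mull trmxK dotC.
have BTx w : dot (B^T *m w) x = dot w v by rewrite dot_mull trmxK vE.
have By w : dot (B *m w) y = dot w u by rewrite dot_mull uE.
rewrite -uE -vE !(dotDl, dotNl, dotZl) BTx By ux !(dotDl, dotNl) => ky kx.
have si0 : 0 < (Lx pi)^-1 by rewrite invr_gt0.
have ti0 : 0 < (Ly pi)^-1 by rewrite invr_gt0.
have c1 : (Lx pi)^-1 * dot p p <= dot p x by rewrite ler_pdivrMl.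
have c2 : (Ly pi)^-1 * dot q q <= dot q y by rewrite ler_pdivrMl.
have y1 := mulr_ge0 (ltW si0) (dot_ge0 (p + u)).
have y2 := mulr_ge0 (ltW ti0) (dot_ge0 (q - v)).
rewrite !(dotDl, dotDr, dotNl, dotNr) (dotC u p) in y1.
rewrite !(dotDl, dotDr, dotNl, dotNr) (dotC v q) in y2.
have k1 : (Lx pi)^-1 * (muyx pi ^+ 2 * dot y y) <= (Lx pi)^-1 * dot u u.
  by rewrite ler_pM2l // uE.
have k2 : (Ly pi)^-1 * (muxy pi ^+ 2 * dot x x) <= (Ly pi)^-1 * dot v v.
  by rewrite ler_pM2l // vE.
have m1 : Num.min (delta_x pi) (delta_y pi) * dot x x <= delta_x pi * dot x x.
  by rewrite ler_wpM2r ?dot_ge0 // ge_min lexx.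
have m2 : Num.min (delta_x pi) (delta_y pi) * dot y y <= delta_y pi * dot y y.
  by rewrite ler_wpM2r ?dot_ge0 // ge_min lexx orbT.
rewrite /delta_x in m1; rewrite /delta_y in m2.
move: (Num.min _ _) m1 m2 => mm m1 m2.
move: ((Lx pi)^-1) ((Ly pi)^-1) si0 ti0 c1 c2 y1 y2 k1 k2 m1 m2 => si ti *.
lra.
Qed.

Let skewed_lip : exists2 K, 0 < K & forall z z',
  dot (skewed_residual z - skewed_residual z')
      (skewed_residual z - skewed_residual z') <= K * dot (z - z') (z - z').
Proof.
pose A := 2 * (Lx pi ^+ 2 + Ly pi ^+ 2 + Lxy pi ^+ 2).
pose S := (Lx pi)^-1 ^+ 2 + (Ly pi)^-1 ^+ 2.
have A0 : 0 < A by rewrite mulr_gt0 // !addr_gt0 ?exprn_gt0.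
have S0 : 0 < S by rewrite addr_gt0 ?exprn_gt0 ?invr_gt0.
exists (4 * A + 2 * S * Lxy pi ^+ 2 * A).
  apply: addr_gt0; apply: mulr_gt0 => //.
  by apply: mulr_gt0; [exact: mulr_gt0 | exact: exprn_gt0].
move=> z z'; rewrite skewedB.
have := grad_lipschitz cf sf Lx_gt0 (usubmx z) (usubmx z').
have := grad_lipschitz cg sg Ly_gt0 (dsubmx z) (dsubmx z').
rewrite dot_col (dot_split (z - z') (z - z')).
move: (grad f _ - grad f _) (grad g _ - grad g _) => p q.
have -> : usubmx z - usubmx z' = usubmx (z - z') by rewrite linearB.
have -> : dsubmx z - dsubmx z' = dsubmx (z - z') by rewrite linearB.
move: (usubmx _) (dsubmx _) => x y hq hp.
have xx := dot_ge0 x; have yy := dot_ge0 y.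
have := coupling_le x; have := coupling_leT y => hy hx.
have [a aE] : exists a, a = p + B^T *m y by eexists.
have [b bE] : exists b, b = q - B *m x by eexists.
have aA : dot a a <= A * (dot x x + dot y y).
  rewrite aE; apply: le_trans (dotD_le _ _) _; rewrite /A.
  have := mulr_ge0 (sqr_ge0 (Ly pi)) (addr_ge0 xx yy).
  have := mulr_ge0 (sqr_ge0 (Lxy pi)) xx; have := mulr_ge0 (sqr_ge0 (Lx pi)) yy.
  lra.
have bA : dot b b <= A * (dot x x + dot y y).
  rewrite bE; apply: le_trans (dotD_le _ _) _; rewrite /A dotNl dotNr opprK.
  have := mulr_ge0 (sqr_ge0 (Lx pi)) (addr_ge0 xx yy).
  have := mulr_ge0 (sqr_ge0 (Lxy pi)) yy; have := mulr_ge0 (sqr_ge0 (Ly pi)) xx.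
  lra.
rewrite -aE -bE; move: (dot x x + dot y y) aA bA => n aA bA.
have h1 := dotD_le a (- ((Ly pi)^-1 *: (B^T *m b))).
have h2 := dotD_le b ((Lx pi)^-1 *: (B *m a)).
rewrite !(dotNl, dotNr, dotZl, dotZr) opprK in h1.
rewrite !(dotZl, dotZr) in h2.
have b1 := le_trans (coupling_leT b) (ler_wpM2l (sqr_ge0 (Lxy pi)) bA).
have a1 := le_trans (coupling_le a) (ler_wpM2l (sqr_ge0 (Lxy pi)) aA).
have b2 := ler_wpM2l (sqr_ge0 (Ly pi)^-1) b1.
have a2 := ler_wpM2l (sqr_ge0 (Lx pi)^-1) a1.
rewrite /S; lra.
Qed.

Lemma solution_in_coset zin : exists2 z, solutions B f g z & V (z - zin).
Proof.
have [K K0 lipK] := skewed_lip.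
have c0 : 0 < Num.min (delta_x pi) (delta_y pi) / 2 by rewrite divr_gt0.
have [z Vz /skewed_residual_zero Sz] := strongly_monotone_zero zin c0 K0
  (@orthogonal_to_closed R _ flat_pairs) (@orthogonal_to0 R _ flat_pairs)
  (@orthogonal_to_lin R _ flat_pairs) V_skewed skewed_mono lipK.
by exists z.
Qed.

Let flat_primal zs : solutions B f g zs -> forall x,
  primal_solutions B f g x -> Kx (x - usubmx zs).
Proof.
move=> [fs gs] x opt; have gE : grad g (dsubmx zs) = B *m usubmx zs.
  by apply/eqP; rewrite -subr_eq0 gs.
have [fx0 Bx0] := primal_solution_flat (bregman_ge0 cf) (bregman_ge0 cg) fs gE Ly_gt0 sg opt.
by apply: flatx => //; have := bregman_ge scf x (usubmx zs); lra.
Qed.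

Let flat_dual zs : solutions B f g zs -> forall y,
  dual_solutions B f g y -> Ky (y - dsubmx zs).
Proof.
move=> [fs gs] y; rewrite dual_solutionsE => opt.
have gE : grad f (usubmx zs) = - B^T *m dsubmx zs.
  by apply/eqP; rewrite mulNmx -addr_eq0 fs.
have fE : grad g (dsubmx zs) + (- B^T)^T *m usubmx zs = 0.
  by rewrite linearN /= trmxK mulNmx.
have [gy0 /eqP] := primal_solution_flat (bregman_ge0 cg) (bregman_ge0 cf) fE gE Lx_gt0 sf opt.
rewrite mulNmx oppr_eq0 => /eqP By0.
by apply: flaty => //; have := bregman_ge scg y (dsubmx zs); lra.
Qed.

(** The components of [zs] are optimal in the primal and dual problems, and all other optima differ
    from them by flat directions, so they are the nearest points. *)
Lemma dist_sq_coset zs z a b : solutions B f g zs -> V (z - zs) ->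
  dist_sq B f g a b z =
  a * dot (usubmx (z - zs)) (usubmx (z - zs)) +
  b * dot (dsubmx (z - zs)) (dsubmx (z - zs)).
Proof.
move=> Szs /orthogonal_pairsP[]; have [fs gs] := Szs.
rewrite !linearB /= => Vx' Vy'; rewrite /dist_sq -!enorm2.
have gE : grad g (dsubmx zs) = B *m usubmx zs.
  by apply/eqP; rewrite -subr_eq0 gs.
have gE' : grad f (usubmx zs) = - B^T *m dsubmx zs.
  by apply/eqP; rewrite mulNmx -addr_eq0 fs.
have fE : grad g (dsubmx zs) + (- B^T)^T *m usubmx zs = 0.
  by rewrite linearN /= trmxK mulNmx.
have Px := primal_solution (bregman_ge0 cf) (bregman_ge0 cg) fs gE.
have Py := primal_solution (bregman_ge0 cg) (bregman_ge0 cf) fE gE'.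
rewrite -dual_solutionsE in Py.
by rewrite (edist_orthogonal Px (flat_primal Szs) Vx').2
           (edist_orthogonal Py (flat_dual Szs) Vy').2.
Qed.

Lemma is_proj_coset zs z : solutions B f g zs -> V (z - zs) ->
  is_proj (solutions B f g) z zs.
Proof.
move=> Szs Vz; split=> //.
apply: (edist_orthogonal Szs _ Vz).1 => z' Sz'; exact: solutions_flat.
Qed.

(** * The functions and operators of the algorithm in the metric P *)

Local Notation P := (@Pmat R dx dy pi).

Implicit Types z zs : 'cV[R]_(dx + dy).

Lemma mulmx_Pmat z :
  P *m z = col_mx (delta_x pi *: usubmx z) (delta_y pi *: dsubmx z).
Proof.
rewrite -[z in LHS]vsubmxK mul_block_col !mul0mx addr0 add0r.
by rewrite !mul_scalar_mx.
Qed.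

Lemma sqn_Pmat z : sqn P z =
  delta_x pi * dot (usubmx z) (usubmx z) + delta_y pi * dot (dsubmx z) (dsubmx z).
Proof. by rewrite /sqn mulmx_Pmat dot_split col_mxKu col_mxKd !dotZl. Qed.

Lemma posdef_Pmat : posdef P.
Proof.
split=> [|u u0].
  by rewrite tr_block_mx !tr_scalar_mx !trmx0.
rewrite -[dot _ _]/(sqn P u) sqn_Pmat.
have x0 := dot_ge0 (usubmx u); have y0 := dot_ge0 (dsubmx u).
rewrite lt_def addr_ge0 ?mulr_ge0 ?(ltW dx_gt0) ?(ltW dy_gt0) // andbT.
rewrite paddr_eq0 ?mulr_ge0 ?(ltW dx_gt0) ?(ltW dy_gt0) //.
by rewrite !mulf_eq0 (gt_eqF dx_gt0) (gt_eqF dy_gt0) /= !dot_eq0 -col_mx_eq0 vsubmxK.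
Qed.

Lemma mulmx_invPmat z : invmx P *m z =
  col_mx ((delta_x pi)^-1 *: usubmx z) ((delta_y pi)^-1 *: dsubmx z).
Proof.
have Pu := posdef_unitmx posdef_Pmat.
have xn0 := lt0r_neq0 dx_gt0; have yn0 := lt0r_neq0 dy_gt0.
rewrite -[z in LHS](_ : P *m col_mx ((delta_x pi)^-1 *: usubmx z)
  ((delta_y pi)^-1 *: dsubmx z) = z) ?mulKmx //.
rewrite mulmx_Pmat col_mxKu col_mxKd !scalerA (mulfV xn0) (mulfV yn0).
by rewrite !scale1r vsubmxK.
Qed.

Lemma orthogonal_Pmat z : V z -> V (P *m z).
Proof.
move=> /orthogonal_pairsP[Vx' Vy']; apply/orthogonal_pairsP.
rewrite mulmx_Pmat col_mxKu col_mxKd -[_ *: usubmx _]addr0 -[_ *: dsubmx _]addr0.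
by split; apply: orthogonal_to_lin => //; exact: orthogonal_to0.
Qed.

Lemma orthogonal_invPmat z : V z -> V (invmx P *m z).
Proof.
move=> /orthogonal_pairsP[Vx' Vy']; apply/orthogonal_pairsP.
rewrite mulmx_invPmat col_mxKu col_mxKd -[_ *: usubmx _]addr0 -[_ *: dsubmx _]addr0.
by split; apply: orthogonal_to_lin => //; exact: orthogonal_to0.
Qed.

Lemma orthogonal_Q i z : V (Q_fam B i z).
Proof.
rewrite /Q_fam; case: eqP => _; last exact: orthogonal_to0.
apply/orthogonal_pairsP; rewrite col_mxKu col_mxKd; split.
  exact: orthogonal_range.
rewrite -mulmxN; exact: orthogonal_rangeT.
Qed.

Lemma Q_monotone i : monotone_op (Q_fam B i).
Proof.
move=> z z'; rewrite /Q_fam; case: eqP => _; last by rewrite subrr dot0l.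
rewrite opp_col_mx add_col_mx dot_split col_mxKu col_mxKd -mulmxBr -opprD -mulmxBr.
have -> : usubmx z - usubmx z' = usubmx (z - z') by rewrite linearB.
have -> : dsubmx z - dsubmx z' = dsubmx (z - z') by rewrite linearB.
by rewrite dotNl dot_mull trmxK dotC subrr.
Qed.

Lemma Q_lipschitz i : lipschitz_op P (M_fam pi i) (Q_fam B i).
Proof.
move=> z z'; rewrite /Q_fam /M_fam; case: eqP => _; last first.
  by rewrite subrr mul0r /normP mulmx0 dot0l sqrtr0.
have k0 : 0 <= kappa_xy pi by rewrite divr_ge0 ?sqr_ge0 // mulr_ge0 ?ltW.
have Pp := posdef_Pmat.
rewrite -ler_sqr ?nnegrE ?mulr_ge0 ?sqrtr_ge0 // exprMn (sqr_sqrtr k0).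
rewrite normP_inv2 // normP2 // -[dot (P *m _) _]/(sqn P _).
rewrite sqn_Pmat mulmx_invPmat opp_col_mx add_col_mx -mulmxBr -opprD -mulmxBr.
have -> : usubmx z - usubmx z' = usubmx (z - z') by rewrite linearB.
have -> : dsubmx z - dsubmx z' = dsubmx (z - z') by rewrite linearB.
rewrite dot_col !col_mxKu !col_mxKd !dotZl dotNl dotNr opprK.
move: (usubmx _) (dsubmx _) => x y.
rewrite /kappa_xy; have := coupling_le x; have := coupling_leT y => hy hx.
have hx' : (delta_y pi)^-1 * dot (B *m x) (B *m x) <=
    (delta_y pi)^-1 * (Lxy pi ^+ 2 * dot x x) by rewrite ler_pM2l ?invr_gt0.
have hy' : (delta_x pi)^-1 * dot (B^T *m y) (B^T *m y) <=
    (delta_x pi)^-1 * (Lxy pi ^+ 2 * dot y y) by rewrite ler_pM2l ?invr_gt0.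
have -> : Lxy pi ^+ 2 / (delta_x pi * delta_y pi) *
    (delta_x pi * dot x x + delta_y pi * dot y y) =
    (delta_y pi)^-1 * (Lxy pi ^+ 2 * dot x x) +
    (delta_x pi)^-1 * (Lxy pi ^+ 2 * dot y y).
  by field; rewrite !gt_eqF.
by rewrite addrC lerD.
Qed.

Lemma constants_pos i : (1 <= i <= 3)%N ->
  [/\ 0 < L_fam pi i, 0 <= M_fam pi i & 0 < L_fam pi i + M_fam pi i].
Proof.
have M0 : 0 <= M_fam pi i by rewrite /M_fam; case: ifP; rewrite ?sqrtr_ge0.
move=> i3; suff L0 : 0 < L_fam pi i by split=> //; rewrite ltr_pwDl.
case: i i3 {M0} => [|[|[|[|i]]]] //= _.
- exact: divr_gt0.
- exact: divr_gt0.
- by rewrite divr_gt0 ?exprn_gt0 ?mulr_gt0.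
Qed.

Context (step_bound : 4 * Num.max (muxy pi) (muyx pi) < Num.sqrt (Lx pi * Ly pi)).

Let muxy_ge0 : 0 <= muxy pi. Proof. by case: adm => _ _ /andP[]. Qed.
Let muyx_ge0 : 0 <= muyx pi. Proof. by case: adm => _ _ _ /andP[]. Qed.

Let sq_bound a : 0 <= a -> a <= Num.max (muxy pi) (muyx pi) ->
  16 * a ^+ 2 <= Lx pi * Ly pi.
Proof.
move=> a0 am; have : 4 * a <= Num.sqrt (Lx pi * Ly pi).
  by apply: le_trans (ltW step_bound); rewrite ler_pM2l.
rewrite -ler_sqr ?nnegrE ?mulr_ge0 ?sqrtr_ge0 // exprMn sqr_sqrtr.
  by rewrite (_ : 4 ^+ 2 = 16 :> R) // -natrX.
by rewrite mulr_ge0 ?ltW.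
Qed.

Let delta_x_le : delta_x pi <= 4 * Lx pi.
Proof.
have h : 16 * muxy pi ^+ 2 <= Lx pi * Ly pi by rewrite sq_bound // le_max lexx.
have h2 : muxy pi ^+ 2 / Ly pi <= Lx pi.
  by rewrite ler_pdivrMr //; have := sqr_ge0 (muxy pi); lra.
by have := Lx_gt0; rewrite /delta_x; case: adm => /andP[_ h1] *; lra.
Qed.

Let delta_y_le : delta_y pi <= 4 * Ly pi.
Proof.
have h : 16 * muyx pi ^+ 2 <= Lx pi * Ly pi by rewrite sq_bound // le_max lexx orbT.
have h2 : muyx pi ^+ 2 / Lx pi <= Ly pi.
  by rewrite ler_pdivrMr //; have := sqr_ge0 (muyx pi); lra.
by have := Ly_gt0; rewrite /delta_y; case: adm => _ /andP[_ h1] *; lra.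
Qed.

Context (xin : 'cV[R]_dx) (yin : 'cV[R]_dy).
Local Notation p := (p_fam B f g pi xin yin).

Definition p_grad i z : 'cV[R]_(dx + dy) :=
  match i with
  | 1 => col_mx (grad f (usubmx z)) 0
  | 2 => col_mx 0 (grad g (dsubmx z))
  | 3 => col_mx (beta_x pi *: (B^T *m (B *m usubmx z - grad g yin)))
                (beta_y pi *: (B *m (B^T *m dsubmx z + grad f xin)))
  | _ => 0
  end.

(** The two-sided bound yields differentiability, the gradient, convexity and smoothness of p_i at
    once. For i = 3 the remainder is exactly the quadratic form beta_x/2 |B x|^2 + beta_y/2 |B^T
    y|^2 of the displacement. *)
Lemma p_remainder i z z' : (1 <= i <= 3)%N ->
  0 <= p i z' - p i z - dot (p_grad i z) (z' - z)
    <= L_fam pi i / 2 * sqn P (z' - z).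
Proof.
rewrite sqn_Pmat dot_split.
have uE : usubmx (z' - z) = usubmx z' - usubmx z by rewrite linearB.
have vE : dsubmx (z' - z) = dsubmx z' - dsubmx z by rewrite linearB.
rewrite uE vE.
have xx := dot_ge0 (usubmx z' - usubmx z); have yy := dot_ge0 (dsubmx z' - dsubmx z).
case: i => [|[|[|[|i]]]] // _ /=; rewrite col_mxKu col_mxKd ?dot0l ?addr0 ?add0r.
- rewrite -/(bregman f (usubmx z') (usubmx z)) bregman_ge0 //=.
  apply: le_trans (bregman_le sf _ _) _.
  have -> : kappa_x pi / 2 * (delta_x pi * dot (usubmx z' - usubmx z) (usubmx z' - usubmx z)
      + delta_y pi * dot (dsubmx z' - dsubmx z) (dsubmx z' - dsubmx z)) =
    Lx pi / 2 * dot (usubmx z' - usubmx z) (usubmx z' - usubmx z) +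
    kappa_x pi / 2 * (delta_y pi * dot (dsubmx z' - dsubmx z) (dsubmx z' - dsubmx z)).
    by rewrite /kappa_x; field; rewrite gt_eqF.
  rewrite lerDl; apply: mulr_ge0; last by rewrite mulr_ge0 // ltW.
  by rewrite divr_ge0 // ltW // divr_gt0.
- rewrite -/(bregman g (dsubmx z') (dsubmx z)) bregman_ge0 //=.
  apply: le_trans (bregman_le sg _ _) _.
  have -> : kappa_y pi / 2 * (delta_x pi * dot (usubmx z' - usubmx z) (usubmx z' - usubmx z)
      + delta_y pi * dot (dsubmx z' - dsubmx z) (dsubmx z' - dsubmx z)) =
    kappa_y pi / 2 * (delta_x pi * dot (usubmx z' - usubmx z) (usubmx z' - usubmx z)) +
    Ly pi / 2 * dot (dsubmx z' - dsubmx z) (dsubmx z' - dsubmx z).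
    by rewrite /kappa_y; field; rewrite gt_eqF.
  rewrite lerDr; apply: mulr_ge0; last by rewrite mulr_ge0 // ltW.
  by rewrite divr_ge0 // ltW // divr_gt0.
have [x xE] : exists x, x = usubmx z' - usubmx z by eexists.
have [y yE] : exists y, y = dsubmx z' - dsubmx z by eexists.
have -> : B *m usubmx z' - grad g yin = B *m x + (B *m usubmx z - grad g yin).
  by rewrite xE mulmxBr addrA subrK.
have -> : B^T *m dsubmx z' + grad f xin = B^T *m y + (B^T *m dsubmx z + grad f xin).
  by rewrite yE mulmxBr addrA subrK.
rewrite -xE -yE in xx yy *.
have hx := coupling_le x; have hy := coupling_leT y.
have bx0 : 0 < beta_x pi by rewrite invr_gt0 mulr_gt0.
have by0 : 0 < beta_y pi by rewrite invr_gt0 mulr_gt0.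
rewrite !enorm2 !dotZl (dot_mull B^T) trmxK (dot_mull B).
move: (B *m _ - grad g yin) (B^T *m _ + grad f xin) => a b.
move: hx hy; move: (B *m x) (B^T *m y) => v u hx hy.
have -> : beta_x pi / 2 * dot (v + a) (v + a) + beta_y pi / 2 * dot (u + b) (u + b)
    - (beta_x pi / 2 * dot a a + beta_y pi / 2 * dot b b)
    - (beta_x pi * dot a v + beta_y pi * dot b u) =
  beta_x pi / 2 * dot v v + beta_y pi / 2 * dot u u.
  by rewrite !dotE (dotC a v) (dotC b u); field.
rewrite addr_ge0 ?(mulr_ge0 _ (dot_ge0 _)) ?divr_ge0 ?(ltW bx0) ?(ltW by0) //=.
have -> : kappa_xy pi / 2 * (delta_x pi * dot x x + delta_y pi * dot y y) =
    (delta_y pi)^-1 / 2 * (Lxy pi ^+ 2 * dot x x) +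
    (delta_x pi)^-1 / 2 * (Lxy pi ^+ 2 * dot y y).
  by rewrite /kappa_xy; field; rewrite !gt_eqF.
(* Here beta_x = 1 / (4 L_y) <= 1 / delta_y and beta_y = 1 / (4 L_x) <= 1 / delta_x, by [delta_y_le]
   and [delta_x_le]. *)
apply: lerD; apply: ler_pM; rewrite ?dot_ge0 ?divr_ge0 ?(ltW bx0) ?(ltW by0) //.
  by rewrite ler_pM2r ?invr_gt0 // lef_pV2 ?posrE ?mulr_gt0.
by rewrite ler_pM2r ?invr_gt0 // lef_pV2 ?posrE ?mulr_gt0.
Qed.

Lemma p_differentiable i z : (1 <= i <= 3)%N ->
  differentiable (p i) z /\ grad (p i) z = p_grad i z.
Proof.
by move=> i3; apply: (remainder_grad posdef_Pmat) => z'; exact: p_remainder.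
Qed.

Lemma p_convex_smooth i : (1 <= i <= 3)%N -> convex_smooth P (L_fam pi i) (p i).
Proof.
by move=> i3 z z'; rewrite /bregman (p_differentiable z' i3).2 p_remainder.
Qed.

Lemma orthogonal_p_grad i z : (1 <= i <= 3)%N -> V (grad (p i) z).
Proof.
move=> i3; rewrite (p_differentiable z i3).2; apply/orthogonal_pairsP.
have Z0 (d : nat) (K : set 'cV[R]_d) a u : orthogonal_to K u -> orthogonal_to K (a *: u).
  move=> Ku; rewrite -[_ *: _]addr0; apply: orthogonal_to_lin => //.
  exact: orthogonal_to0.
case: i i3 => [|[|[|[|i]]]] // _ /=; rewrite col_mxKu col_mxKd; split.
- exact: orthogonal_grad.
- exact: orthogonal_to0.
- exact: orthogonal_to0.
- exact: orthogonal_grad.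
- by apply: Z0; exact: orthogonal_range.
- by apply: Z0; exact: orthogonal_rangeT.
Qed.

(** Let D denote the sum of the two Bregman distances to zs, and r the squared P-distance of zin to
    zs. Cocoercivity gives p_3(zs) <= D(zin) / 4, so the gap bound reads D(zout) + p_3(zout) <= r/24
    + D(zin)/4. Since delta_x = mu_x + 4 beta_x mu_xy^2, and likewise for y, the distance term of
    Psi(zout) is at most 2 D(zout) + 16 p_3(zout) + 4 D(zin). Hence Psi(zout) <= 16 (r/24 +
    D(zin)/4) + 4 D(zin) = 2/3 (r + 12 D(zin)). *)
Lemma Psi_contraction zs zout : let zin := col_mx xin yin in
  solutions B f g zs -> V (zin - zs) -> V (zout - zs) ->
  \sum_(1 <= i < 4) p i zout - \sum_(1 <= i < 4) p i zs +
  \sum_(1 <= i < 4) dot (Q_fam B i zs) (zout - zs) <= 24^-1 * sqn P (zin - zs) ->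
  Psi B f g pi zs zout <= 2 / 3 * Psi B f g pi zs zin.
Proof.
move=> zin Szs Vin Vout; rewrite /Psi !(dist_sq_coset _ _ Szs) // sqn_Pmat.
have [fs gs] := Szs; have /orthogonal_pairsP[Vx' Vy'] := Vout.
have gE : grad g (dsubmx zs) = B *m usubmx zs by apply/eqP; rewrite -subr_eq0 gs.
have fE : grad f (usubmx zs) = - (B^T *m dsubmx zs).
  by apply/eqP; rewrite -addr_eq0 fs.
rewrite unlock /= !addr0 /Q_fam /= !dot0l !add0r dot_split col_mxKu col_mxKd.
have uB u : usubmx (u - zs) = usubmx u - usubmx zs by rewrite linearB.
have vB u : dsubmx (u - zs) = dsubmx u - dsubmx zs by rewrite linearB.
rewrite !uB !vB in Vx' Vy' *; rewrite col_mxKu col_mxKd !enorm2.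
have hin1 := grad_bregman cf sf Lx_gt0 xin (usubmx zs).
have hin2 := grad_bregman cg sg Ly_gt0 yin (dsubmx zs).
have D1E : bregman f (usubmx zout) (usubmx zs) = f (usubmx zout) - f (usubmx zs)
    + dot (B^T *m dsubmx zs) (usubmx zout - usubmx zs).
  by rewrite /bregman fE dotNl opprK.
have D2E : bregman g (dsubmx zout) (dsubmx zs) = g (dsubmx zout) - g (dsubmx zs)
    - dot (B *m usubmx zs) (dsubmx zout - dsubmx zs).
  by rewrite /bregman gE.
have D1ge := bregman_ge scf (usubmx zout) (usubmx zs).
have D2ge := bregman_ge scg (dsubmx zout) (dsubmx zs).
have -> : B^T *m dsubmx zs + grad f xin = grad f xin - grad f (usubmx zs).
  by rewrite fE opprK addrC.
have -> : B *m usubmx zs - grad g yin = - (grad g yin - grad g (dsubmx zs)).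
  by rewrite gE opprB.
have aE : B *m (usubmx zout - usubmx zs) =
    (B *m usubmx zout - grad g yin) + (grad g yin - grad g (dsubmx zs)).
  by rewrite gE mulmxBr addrA subrK.
have cE : B^T *m (dsubmx zout - dsubmx zs) =
    (B^T *m dsubmx zout + grad f xin) + - (grad f xin - grad f (usubmx zs)).
  by rewrite fE opprK mulmxBr opprD addrA addrK.
have sx := coupling_ge Vx'; have sy := coupling_geT Vy'.
rewrite aE in sx; rewrite cE in sy.
have {}sx := le_trans sx (dotD_le _ _); have {}sy := le_trans sy (dotD_le _ _).
have bx0 : 0 < beta_x pi by rewrite invr_gt0 mulr_gt0.
have by0 : 0 < beta_y pi by rewrite invr_gt0 mulr_gt0.
have {}sx := ler_wpM2l (ltW bx0) sx; have {}sy := ler_wpM2l (ltW by0) sy.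
have {}hin1 := ler_wpM2l (ltW by0) hin1; have {}hin2 := ler_wpM2l (ltW bx0) hin2.
rewrite !(dotNl, dotNr) !opprK in sx sy hin1 hin2 *.
have bE1 c : beta_y pi * (2 * Lx pi * c) = c / 2.
  by rewrite /beta_y; field; rewrite gt_eqF.
have bE2 c : beta_x pi * (2 * Ly pi * c) = c / 2.
  by rewrite /beta_x; field; rewrite gt_eqF.
rewrite bE1 in hin1; rewrite bE2 in hin2.
have dxE c : delta_x pi * c = mux pi * c + 4 * (beta_x pi * (muxy pi ^+ 2 * c)).
  by rewrite /delta_x /beta_x; field; rewrite gt_eqF.
have dyE c : delta_y pi * c = muy pi * c + 4 * (beta_y pi * (muyx pi ^+ 2 * c)).
  by rewrite /delta_y /beta_y; field; rewrite gt_eqF.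
rewrite (dxE (dot (usubmx zout - _) _)) (dyE (dot (dsubmx zout - _) _)).
move: (delta_x pi * _ + delta_y pi * _) => r.
have D1ge0 := bregman_ge0 cf (usubmx zout) (usubmx zs).
have D2ge0 := bregman_ge0 cg (dsubmx zout) (dsubmx zs).
rewrite D1E D2E in D1ge D2ge D1ge0 D2ge0 *; lra.
Qed.

End SaddlePoint.

(** * Consequences of the iteration rule *)

Section IterationCounts.
Context {R : realType} (eps : R) (L M : nat -> R) (eps_gt0 : 0 < eps).

Local Notation m := (complexity eps L M).
Local Notation T := (iter_counts m).

Let m_gt0 i : 0 < m i.
Proof. by rewrite lt_max ltr01 orbT. Qed.

Let absz_ceil_ge (x : R) : x <= `|Num.ceil x|%N%:R.
Proof. by apply: le_trans (ceil_ge x) _; rewrite natr_absz ler_int ler_norm. Qed.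

Lemma iter_counts_gt0 i : (0 < T i)%N.
Proof.
rewrite -(ltr0n R); apply: lt_le_trans (absz_ceil_ge _).
by case: ifP => _; rewrite ?divr_gt0 ?mulr_gt0.
Qed.

Let alpha_count i : alpha (T i).-1 <= 2 / (T i)%:R :> R.
Proof.
apply: le_trans (alpha_le _) _; rewrite prednK ?iter_counts_gt0 // ler_pM2l //.
by rewrite lef_pV2 ?posrE ?ltr0n ?iter_counts_gt0 // ler_nat.
Qed.

(** The counts give alpha (T_j - 1) <= 2 / T_j <= m_(j-1) / m_j, with 1 / m_1 for j = 1, and the
    product telescopes. *)
Lemma prod_alpha_le l : \prod_(1 <= j < l.+2) alpha (T j).-1 <= (m l.+1)^-1.
Proof.
elim: l => [|l IH].
  rewrite big_nat1; apply: le_trans (alpha_count _) _.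
  rewrite ler_pdivrMr ?ltr0n ?iter_counts_gt0 // ler_pdivlMl // mulrC.
  exact: absz_ceil_ge.
rewrite big_nat_recr //=.
apply: le_trans (_ : (m l.+1)^-1 * (m l.+1 / m l.+2) <= _); last first.
  by rewrite mulKf // gt_eqF.
apply: ler_pM => //.
- by apply: prodr_ge0 => j _; rewrite ltW ?alpha_gt0.
- by rewrite ltW ?alpha_gt0.
apply: le_trans (alpha_count _) _; rewrite ler_pdivrMr ?ltr0n ?iter_counts_gt0 //.
rewrite -[leLHS](_ : m l.+1 / m l.+2 * (2 * m l.+2 / m l.+1) = 2); last first.
  by field; rewrite !gt_eqF.
by rewrite ler_pM2l ?divr_gt0 // absz_ceil_ge.
Qed.

(** With w the product of the alphas, the weight is (L w^2 + M w) / 2. By definition of m, L <= eps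
    m^2 and M <= eps m, while m w <= 1. *)
Lemma warm_weight_le l : 0 <= L l.+1 -> 0 <= M l.+1 ->
  warm_weight L M T l.+1 1 <= eps.
Proof.
move=> L0 M0; have := prod_alpha_le l.
rewrite /warm_weight /step_const; set w := \prod_(1 <= j < l.+2) _ => wm.
have w0 : 0 < w by apply: prodr_gt0 => j _; exact: alpha_gt0.
have -> : 2^-1 * (L l.+1 + M l.+1 / w) * w ^+ 2 =
    (L l.+1 * w ^+ 2 + M l.+1 * w) / 2 by field; rewrite gt_eqF.
have hL : L l.+1 <= eps * m l.+1 ^+ 2.
  rewrite mulrC -ler_pdivrMr // -(sqr_sqrtr (_ : 0 <= L l.+1 / eps)).
    by rewrite ler_sqr ?nnegrE ?sqrtr_ge0 ?(ltW (m_gt0 _)) // /complexity !le_max lexx.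
  by rewrite divr_ge0 // ltW.
have hM : M l.+1 <= eps * m l.+1.
  by rewrite mulrC -ler_pdivrMr // /complexity !le_max lexx orbT.
have mw : m l.+1 * w <= 1 by rewrite -ler_pdivlMl // mulr1.
have e1 : L l.+1 * w ^+ 2 <= eps.
  apply: le_trans (_ : eps * m l.+1 ^+ 2 * w ^+ 2 <= _).
    by rewrite ler_pM2r // exprn_gt0.
  rewrite -mulrA -exprMn ler_piMr ?(ltW eps_gt0) // exprn_ile1 //.
  by rewrite mulr_ge0 ?ltW.
have e2 : M l.+1 * w <= eps.
  apply: le_trans (_ : eps * m l.+1 * w <= _); first by rewrite ler_pM2r.
  by rewrite -mulrA ler_piMr ?(ltW eps_gt0).
lra.
Qed.

End IterationCounts.

(** * Reordering of the pairs, and assembly of the result *)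

Lemma reorder_range n (s : seq nat) i : perm_eq s (iota 1 n) ->
  (1 <= i <= n)%N -> (1 <= nth 0%N s i.-1 <= n)%N.
Proof.
move=> ps /andP[i1 iln]; have ss : size s = n by rewrite (perm_size ps) size_iota.
have : nth 0%N s i.-1 \in s by rewrite mem_nth // ss prednK.
by rewrite (perm_mem ps) mem_iota add1n ltnS.
Qed.

(** The left-hand side of the gap estimate involves the families only through full sums, so an
    estimate for the reordered families holds for the original ones. *)
Lemma reorder_sum {R : realType} n (s : seq nat) (F : nat -> R) :
  perm_eq s (iota 1 n) ->
  \sum_(1 <= i < n.+1) F (nth 0%N s i.-1) = \sum_(1 <= i < n.+1) F i.
Proof.
move=> ps; have ss : size s = n by rewrite (perm_size ps) size_iota.
rewrite big_add1 /= -{1}ss -(big_nth 0%N predT F) (perm_big _ ps) /=.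
by rewrite /index_iota subSS subn0.
Qed.

Theorem theorem4 (R : realType) :
  exists eps : R, 0 < eps /\
  forall (dx dy : nat) (B : 'M[R]_(dy, dx))
    (f : 'cV[R]_dx -> R) (g : 'cV[R]_dy -> R) (pi : params R)
    (xin : 'cV[R]_dx) (yin : 'cV[R]_dy),
  (forall x, differentiable f x) -> convex f ->
  (forall y, differentiable g y) -> convex g ->
  admissible pi -> regular B f g pi ->
  4 * mux pi < Lx pi ->
  4 * muy pi < Ly pi ->
  18 * Num.max (Num.max (muxy pi) (muyx pi)) (Num.sqrt (mux pi * muy pi))
    < Lxy pi ->
  4 * Num.max (muxy pi) (muyx pi) < Num.sqrt (Lx pi * Ly pi) ->
  0 < Num.min (delta_x pi) (delta_y pi) ->
  let p := p_fam B f g pi xin yin in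
  let Q := Q_fam B in
  let L := L_fam pi in
  let M := M_fam pi in
  let P := Pmat pi in
  (forall i, (1 <= i <= 3)%N ->
     [/\ forall z, differentiable (p i) z,
         monotone_op (grad (p i)) /\ lipschitz_op P (L i) (grad (p i)),
         monotone_op (Q i) /\ lipschitz_op P (M i) (Q i) &
         [/\ 0 <= L i, 0 <= M i & 0 < L i + M i]])
  /\
  (forall s : seq nat, sorting 3 (complexity eps L M) s ->
     let T := iter_counts (reorder s (complexity eps L M)) in
     let zin := col_mx xin yin in
     let zout := algorithm1 3 P setT (reorder s p) (reorder s Q)
                   (reorder s L) (reorder s M) T zin in
     exists zs : 'cV[R]_(dx + dy),
       [/\ is_proj (solutions B f g) zin zs,
           is_proj (solutions B f g) zout zs &
           Psi B f g pi zs zout <= 2 / 3 * Psi B f g pi zs zin]).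
Proof.
(* Three levels of weight at most 1/72 give the factor 1/24 required by [Psi_contraction], where
   16/24 = 2/3. *)
exists 72^-1; split=> // dx dy B f g pi xin yin _ cf _ cg adm reg _ _ _ step_bound.
move=> delta_gt0 p Q L M P.
have pos i : (1 <= i <= 3)%N -> [/\ 0 <= L i, 0 <= M i & 0 < L i + M i].
  by move=> i3; have [/ltW] := constants_pos adm delta_gt0 i3; split.
have p_cs i : (1 <= i <= 3)%N -> convex_smooth P (L i) (p i).
  exact: p_convex_smooth.
have Ppos : posdef P by exact: posdef_Pmat.
have Q_lip i : lipschitz_op P (M i) (Q i) by exact: Q_lipschitz adm reg delta_gt0 i.
split=> [i i3|s [ps _] T zin zout].
  have [L0 _ _] := constants_pos adm delta_gt0 i3.
  have p_ge0 x y : 0 <= bregman (p i) x y by case/andP: (p_cs i i3 x y).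
  split=> //; [|split|split=> //|exact: pos].
  - by move=> z; apply: (p_differentiable cf cg adm reg delta_gt0 step_bound xin yin z i3).1.
  - exact: bregman_monotone.
  - apply: bregman_lipschitz => // x y.
    by rewrite normP2 //; case/andP: (p_cs i i3 x y).
  - exact: Q_monotone.
pose V := orthogonal_to (flat_pairs B f g).
have [zs Szs Vzs] := solution_in_coset cf cg adm reg delta_gt0 zin.
have V_lin a u v : V u -> V v -> V (a *: u + v) by exact: orthogonal_to_lin.
have V0 : V 0 by exact: orthogonal_to0.
have VN u : V u -> V (- u).
  by move=> Vu; rewrite -scaleN1r -[_ *: _]addr0; exact: V_lin.
have s3 i : (1 <= i <= 3)%N -> (1 <= nth 0%N s i.-1 <= 3)%N by exact: reorder_range.
have [|||||||||Vout gap] := @algorithm1_gap R _ 3 P (reorder s Q) (reorder s L)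
    (reorder s M) T V zin Ppos isT _ _ _ _ _ V_lin _ _ _ (reorder s p).
- by move=> i _; exact: iter_counts_gt0.
- by move=> i /s3/pos.
- by move=> i _; exact: Q_monotone.
- by move=> i _; exact: Q_lip.
- exact: V0.
- by move=> u; exact: orthogonal_Pmat.
- by move=> u; exact: orthogonal_invPmat.
- by move=> i z _; exact: orthogonal_Q.
- move=> i /s3 i3; split; first exact: p_cs.
  by move=> z; exact: (orthogonal_p_grad cf cg adm reg delta_gt0 step_bound).
have Vin : V (zin - zs) by rewrite -opprB; exact: VN.
(* The output stays in the coset of [zin], so the solution chosen for [zin] is also the projection
   of [zout]. *)
have Vouts : V (zout - zs).
  by rewrite -(subrK zin zout) -addrA -[X in V (X + _)]scale1r; exact: V_lin.
exists zs; split.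
- exact: (is_proj_coset cf cg adm reg delta_gt0).
- exact: (is_proj_coset cf cg adm reg delta_gt0).
apply: (Psi_contraction cf cg adm reg delta_gt0 Szs Vin Vouts).
have := gap zs; rewrite (reorder_sum (fun i => p i _) ps) (reorder_sum (fun i => p i zs) ps).
rewrite (reorder_sum (fun i => dot (Q i zs) _) ps) => /le_trans; apply.
apply: le_trans (_ : \sum_(1 <= l < 4) 72^-1 * sqn P (zin - zs) <= _).
  apply: ler_sum_nat => -[//|l] l3; have [L0 M0 _] := pos _ (s3 l.+1 l3).
  by rewrite ler_wpM2r ?sqn_ge0 // warm_weight_le.
have e a : 3%:R * (72^-1 * a) = 24^-1 * a :> R by field.
by rewrite sumr_const_nat subn1 -[leLHS]mulr_natl e.
Qed.
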